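(* Let $R=\mathbb{Q}[t^{2},t^{3},z,z^{-1}]$, the subring of $\mathbb{Q}[t,z,z^{-1}]$ generated over $\mathbb{Q}$ by $t^2,t^3,z,z^{-1}$, and let $s$ be a polynomial variable over $R$. (1) The class of the matrix $$\begin{pmatrix} 1-(1-z^{-1})s^{4}t^{4} & (z-1)(s^{2}t^{2}-s^{3}t^{3}) \\ (1-z^{-1})(s^{2}t^{2})(1+st+s^{2}t^{2}+s^{3}t^{3}) & 1+(z-1)(s^{4}t^{4}) \end{pmatrix}$$ over $R[s]$ is not zero in $NK_{1}(R)=\ker\bigl(K_1(R[s])\xrightarrow{s\mapsto 0}K_1(R)\bigr)$. (2) The class of the $10\times 10$ matrix $$\begin{pmatrix} 0&0&0&(1-z)t^2&0&(1-z)(-t^3)&(1-z^{-1})t^4&0&0&0\\ 0&0&(z^{-1}-1)t^2&0&(z^{-1}-1)t^3&0&(z^{-1}-1)t^4&(1-z)t^4&(z^{-1}-1)t^5&0\\ 1&0&0&0&0&0&0&0&0&0\\ 0&1&0&0&0&0&0&0&0&0\\ 0&0&1&0&0&0&0&0&0&0\\ 0&0&0&1&0&0&0&0&0&0\\ 0&0&0&0&1&0&0&0&0&0\\ 0&0&0&0&0&1&0&0&0&0\\ 0&0&0&0&0&0&1&0&0&0\\ 0&0&0&0&0&0&0&1&0&0 \end{pmatrix}$$ over $R$ is non-zero in $Nil_{0}(R)$.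
   Context: For an associative ring $\mathcal{R}$ with $1$, $K_1(\mathcal{R})=GL(\mathcal{R})/El(\mathcal{R})$, where $GL(\mathcal{R})$ is the stabilized general linear group over $\mathcal{R}$ and $El(\mathcal{R})$ is its stabilized elementary subgroup. The group $NK_1(\mathcal{R})$ is the kernel of the map $K_1(\mathcal{R}[s])\to K_1(\mathcal{R})$ induced by $s\mapsto 0$, where $s$ is a polynomial variable. The category $\mathbf{Nil}\,\mathcal{R}$ has as objects the pairs $(P,f)$ with $P$ a finitely generated projective $\mathcal{R}$-module and $f$ a nilpotent endomorphism of $P$; a morphism $(P,f)\to(Q,g)$ is an $\mathcal{R}$-module homomorphism $h:P\to Q$ with $hf=gh$. A sequence in $\mathbf{Nil}\,\mathcal{R}$ is declared exact if its image under the forgetful functor $(P,f)\mapsto P$ to the category $\mathbf{Proj}\,\mathcal{R}$ of finitely generated projective $\mathcal{R}$-modules is exact; $K_0(\mathbf{Nil}\,\mathcal{R})$ is the $K_0$-group of this exact category. The group $Nil_0(\mathcal{R})$ is the cokernel of the map $K_0(\mathbf{Proj}\,\mathcal{R})\to K_0(\mathbf{Nil}\,\mathcal{R})$, $[P]\mapsto[(P,0)]$. The class in $Nil_0(\mathcal{R})$ of a nilpotent $n\times n$ matrix $N$ over $\mathcal{R}$ is the class of $(\mathcal{R}^n,N)$, with $N$ viewed as an endomorphism of $\mathcal{R}^n$. *)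

(* Defs.v *)
From HB Require Import structures.
From mathcomp Require Import all_boot all_order all_algebra.
From mathcomp Require Import boolp ring.

Set Implicit Arguments.
Unset Strict Implicit.
Unset Printing Implicit Defensive.

Import GRing.Theory.
Local Open Scope ring_scope.

(* [rows] is read row by row; missing entries are 0. *)
Definition mx_of_rows (R : pzRingType) (n : nat) (rows : seq (seq R)) : 'M[R]_n :=
  \matrix_(i < n, j < n) nth 0 (nth [::] rows i) j.

(* [unitmx] is only available over commutative unit rings, and polynomial
   rings over general rings are not among those. *)
Definition mx_invertible (R : pzRingType) (n : nat) (A : 'M[R]_n) : Prop :=
  exists B : 'M[R]_n, A *m B = 1%:M /\ B *m A = 1%:M.

(* The block matrix diag(A, 1) of size m, when n <= m. *)
Definition stab_mx (R : pzRingType) (n m : nat) (A : 'M[R]_n) : 'M[R]_m :=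
  \matrix_(i < m, j < m)
    match insub (i : nat), insub (j : nat) with
    | Some i', Some j' => A i' j'
    | _, _ => (i == j)%:R
    end.

(* An element of GL(R) = colim_n GL_n(R) is represented at a finite level n. *)
Record GL (R : pzRingType) := MkGL {
  GL_dim : nat;
  GL_mx : 'M[R]_GL_dim;
  GL_inv : mx_invertible GL_mx }.

(* The inverse of the elementary matrix e_ij(a) is e_ij(- a), so the products
   of elementary matrices form a group. *)
Inductive El_mx (R : pzRingType) (n : nat) : 'M[R]_n -> Prop :=
| El_mx1 : El_mx 1%:M
| El_mxM (i j : 'I_n) (a : R) (E : 'M[R]_n) :
    i != j -> El_mx E -> El_mx ((1%:M + a *: delta_mx i j) *m E).

(* Equality of classes in K_1(R) = GL(R)/El(R): the coset relation, computed
   at a level m where both representatives and the elementary factor live. *)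
Definition K1_eq (R : pzRingType) (g h : GL R) : Prop :=
  exists (m : nat) (E : 'M[R]_m),
    [/\ (GL_dim g <= m)%N, (GL_dim h <= m)%N, El_mx E &
        stab_mx m (GL_mx g) = E *m stab_mx m (GL_mx h)].

Lemma mx_invertible1 (R : pzRingType) (n : nat) :
  mx_invertible (1%:M : 'M[R]_n).
Proof. by exists 1%:M; rewrite mulmx1. Qed.

Definition GL_one (R : pzRingType) : GL R := MkGL (mx_invertible1 R 0).

Lemma mx_invertible_map (R S : pzRingType) (f : {rmorphism R -> S}) (n : nat)
  (A : 'M[R]_n) : mx_invertible A -> mx_invertible (map_mx f A).
Proof.
by case=> B [AB BA]; exists (map_mx f B); rewrite -!map_mxM AB BA map_mx1.
Qed.

Definition GL_map (R S : pzRingType) (f : {rmorphism R -> S}) (g : GL R) : GL S :=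
  MkGL (mx_invertible_map f (GL_inv g)).

(* [coefp 0 p] is the constant coefficient of p, i.e. the value of p at s = 0
   (horner_coef0); it is a ring morphism over any ring. *)
Definition in_NK1 (R : nzRingType) (g : GL {poly R}) : Prop :=
  K1_eq (GL_map (coefp 0 : {rmorphism {poly R} -> R}) g) (GL_one R).

(* Only the objects and the triples (X, Y, Z) fitting in a short exact sequence
   0 -> X -> Y -> Z -> 0 matter for K_0. *)
Record exactCat := ExactCat {
  obj : Type;
  ses : obj -> obj -> obj -> Prop }.

(* K_0 as the abelian group presented by generators and relations: formal
   expressions, modulo [K0_eq].  It is not given a [zmodType] structure, since
   the objects (modules) live in a universe above the one of [zmodType]s. *)
Inductive K0 (C : exactCat) : Type :=
| K0_class of obj C
| K0_zero
| K0_opp of K0 C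
| K0_add of K0 C & K0 C.

Arguments K0_class {C}.
Arguments K0_zero {C}.

Inductive K0_eq (C : exactCat) : K0 C -> K0 C -> Prop :=
| K0_refl x : K0_eq x x
| K0_sym x y : K0_eq x y -> K0_eq y x
| K0_trans x y z : K0_eq x y -> K0_eq y z -> K0_eq x z
| K0_oppE x x' : K0_eq x x' -> K0_eq (K0_opp x) (K0_opp x')
| K0_addE x x' y y' :
    K0_eq x x' -> K0_eq y y' -> K0_eq (K0_add x y) (K0_add x' y')
| K0_addA x y z : K0_eq (K0_add x (K0_add y z)) (K0_add (K0_add x y) z)
| K0_addC x y : K0_eq (K0_add x y) (K0_add y x)
| K0_add0 x : K0_eq (K0_add K0_zero x) x
| K0_addN x : K0_eq (K0_add (K0_opp x) x) K0_zero
| K0_ses X Y Z : ses X Y Z ->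
    K0_eq (K0_class Y) (K0_add (K0_class X) (K0_class Z)).

Fixpoint K0_map (C D : exactCat) (F : obj C -> obj D) (x : K0 C) : K0 D :=
  match x with
  | K0_class X => K0_class (F X)
  | K0_zero => K0_zero
  | K0_opp x => K0_opp (K0_map F x)
  | K0_add x y => K0_add (K0_map F x) (K0_map F y)
  end.

Lemma K0_map_eq (C D : exactCat) (F : obj C -> obj D) :
  (forall X Y Z, ses X Y Z -> ses (F X) (F Y) (F Z)) ->
  forall x y, K0_eq x y -> K0_eq (K0_map F x) (K0_map F y).
Proof.
move=> Fses x y; elim=> {x y} /=; try by move=> *; constructor; auto.
by move=> x y z _ IHxy _ IHyz; apply: K0_trans IHxy IHyz.
Qed.

Definition fin_generated (R : pzRingType) (P : lmodType R) : Prop :=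
  exists (n : nat) (g : 'I_n -> P),
    forall x : P, exists c : 'I_n -> R, x = \sum_i c i *: g i.

Definition projective (R : pzRingType) (P : lmodType R) : Prop :=
  forall (A B : lmodType R) (q : {linear A -> B}) (h : {linear P -> B}),
    (forall b, exists a, q a = b) ->
    exists h' : {linear P -> A}, forall x, q (h' x) = h x.

Record projMod (R : pzRingType) := ProjMod {
  proj_mod : lmodType R;
  proj_fg : fin_generated proj_mod;
  proj_proj : projective proj_mod }.

Definition short_exact (R : pzRingType) (A B C : lmodType R)
    (i : {linear A -> B}) (p : {linear B -> C}) : Prop :=
  [/\ injective i, (forall c, exists b, p b = c) &
      forall b, p b = 0 <-> exists a, i a = b].

Definition Proj (R : pzRingType) : exactCat :=
  @ExactCat (projMod R) (fun X Y Z =>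
    exists (i : {linear proj_mod X -> proj_mod Y})
           (p : {linear proj_mod Y -> proj_mod Z}), short_exact i p).

Record nilMod (R : pzRingType) := NilMod {
  nil_mod : projMod R;
  nil_end : {linear proj_mod nil_mod -> proj_mod nil_mod};
  nil_nilp : exists k, forall x, iter k nil_end x = 0 }.

Definition nil_hom (R : pzRingType) (X Y : nilMod R)
    (h : {linear proj_mod (nil_mod X) -> proj_mod (nil_mod Y)}) : Prop :=
  forall x, h (nil_end X x) = nil_end Y (h x).

Definition Nil (R : pzRingType) : exactCat :=
  @ExactCat (nilMod R) (fun X Y Z =>
    exists (i : {linear proj_mod (nil_mod X) -> proj_mod (nil_mod Y)})
           (p : {linear proj_mod (nil_mod Y) -> proj_mod (nil_mod Z)}),
      [/\ nil_hom i, nil_hom p & short_exact i p]).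

Lemma zero_end_nilp (R : pzRingType) (P : lmodType R) :
  exists k, forall x, iter k (\0 : {linear P -> P}) x = 0.
Proof. by exists 1%N. Qed.

Definition nil_of_proj (R : pzRingType) (P : projMod R) : nilMod R :=
  @NilMod R P (\0 : {linear proj_mod P -> proj_mod P})
    (zero_end_nilp (proj_mod P)).

Lemma nil_of_proj_ses (R : pzRingType) (X Y Z : obj (Proj R)) :
  ses X Y Z ->
  @ses (Nil R) (nil_of_proj X) (nil_of_proj Y) (nil_of_proj Z).
Proof.
by case=> i [p ip]; exists i, p; split=> // x; rewrite /= linear0.
Qed.

(* Elements of Nil_0(R) are represented by elements of K_0(Nil R); this is
   equality in the cokernel of K_0(Proj R) -> K_0(Nil R), [P] |-> [(P, 0)]. *)
Definition Nil0_eq (R : pzRingType) (x y : K0 (Nil R)) : Prop :=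
  exists u : K0 (Proj R),
    K0_eq x (K0_add (@K0_map (Proj R) (Nil R) (@nil_of_proj R) u) y).

Lemma cV_sum_delta (R : pzRingType) (n : nat) (v : 'cV[R]_n) :
  v = \sum_i v i 0 *: delta_mx i 0.
Proof. by rewrite {1}[v]matrix_sum_delta; apply: eq_bigr => i _; rewrite big_ord1. Qed.

Lemma cV_fg (R : pzRingType) (n : nat) : fin_generated 'cV[R]_n.
Proof.
exists n, (fun i => delta_mx i 0) => x; exists (fun i => x i 0).
exact: cV_sum_delta.
Qed.

Lemma cV_projective (R : pzRingType) (n : nat) : projective 'cV[R]_n.
Proof.
move=> A B q h q_surj.
have ex i : exists a, q a == h (delta_mx i 0).
  by have [a qa] := q_surj (h (delta_mx i 0)); exists a; apply/eqP.
pose a i := xchoose (ex i).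
pose h' (v : 'cV[R]_n) := \sum_i v i 0 *: a i.
have h'_lin : linear h'.
  move=> c u v; rewrite /h' scaler_sumr -big_split; apply: eq_bigr => i _ /=.
  by rewrite !mxE scalerDl scalerA.
pose m := GRing.isLinear.Build R 'cV[R]_n A *:%R h' h'_lin.
pose h'L : {linear 'cV[R]_n -> A} := HB.pack h' m.
exists h'L => v; rewrite /= /h' [in RHS](cV_sum_delta v) !linear_sum.
by apply: eq_bigr => i _; rewrite !linearZ /= (eqP (xchooseP (ex i))).
Qed.

Definition cV_projMod (R : pzRingType) (n : nat) : projMod R :=
  ProjMod (@cV_fg R n) (@cV_projective R n).

Definition mx_nilpotent (R : pzRingType) (n : nat) (N : 'M[R]_n) : Prop :=
  exists k : nat, N ^+ k = 0.

Lemma mulmx_nilp (R : comPzRingType) (n : nat) (N : 'M[R]_n) :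
  mx_nilpotent N ->
  exists k, forall x : 'cV[R]_n, iter k (mulmx N) x = 0.
Proof.
case=> k Nk; exists k => x.
suff -> : iter k (mulmx N) x = (N ^+ k) *m x by rewrite Nk mul0mx.
elim: k {Nk} => [|k IHk] /=; first by rewrite expr0 mul1mx.
by rewrite IHk exprS mulmxA.
Qed.

(* (R^n, N) for R commutative, with N acting on column vectors on the left. *)
Definition nil_of_mx (R : comPzRingType) (n : nat) (N : 'M[R]_n)
    (hN : mx_nilpotent N) : nilMod R :=
  @NilMod R (cV_projMod R n) (mulmx N : {linear 'cV[R]_n -> 'cV[R]_n})
    (mulmx_nilp hN).

Definition Nil0_class (R : comPzRingType) (n : nat) (N : 'M[R]_n)
    (hN : mx_nilpotent N) : K0 (Nil R) :=
  @K0_class (Nil R) (nil_of_mx hN).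

(* Q[t, z, z^-1] and its subrings are realized inside the field Q(t, z), the
   fraction field of Q[t][z]: z is the outer variable, t the inner one. *)
Definition Qtz : fieldType := {fraction {poly {poly rat}}}.
Definition Qconst (c : rat) : Qtz := tofrac (c%:P%:P).
Definition tF : Qtz := tofrac ('X%:P).
Definition zF : Qtz := tofrac 'X.

(* The subring generated by G over Q: the intersection of all the subrings
   containing Q and G. *)
Definition Qgen (G : seq Qtz) : {pred Qtz} := fun x =>
  `[< forall S : {pred Qtz}, subring_closed S ->
        (forall c : rat, Qconst c \in S) -> {subset G <= S} -> x \in S >].

Lemma Qgen_subring (G : seq Qtz) : subring_closed (Qgen G).
Proof.
split.
- by apply/asboolP => S [S1 _ _].
- move=> x y /asboolP Gx /asboolP Gy; apply/asboolP => S Sr SQ SG.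
  by case: (Sr) => _ SB _; apply: SB; [apply: Gx | apply: Gy].
- move=> x y /asboolP Gx /asboolP Gy; apply/asboolP => S Sr SQ SG.
  by case: (Sr) => _ _ SM; apply: SM; [apply: Gx | apply: Gy].
Qed.

HB.instance Definition _ (G : seq Qtz) :=
  GRing.isSubringClosed.Build Qtz (Qgen G) (Qgen_subring G).

Lemma Qgen_incl (G : seq Qtz) x : x \in G -> x \in Qgen G.
Proof. by move=> Gx; apply/asboolP => S _ _; apply. Qed.

Definition laurent_gens : seq Qtz := [:: tF; zF; zF^-1].
Definition cusp_gens : seq Qtz := [:: tF ^+ 2; tF ^+ 3; zF; zF^-1].

Lemma cusp_sub_laurent : {subset Qgen cusp_gens <= Qgen laurent_gens}.
Proof.
move=> x /asboolP; apply; first exact: Qgen_subring.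
  by move=> c; apply/asboolP => S _ SQ _; apply: SQ.
have Lt : tF \in Qgen laurent_gens by apply: Qgen_incl; exact: mem_head.
move=> y; rewrite !inE => /or4P[] /eqP->; [exact: rpredX|exact: rpredX| |].
- apply: Qgen_incl; rewrite in_cons; apply/orP; right; exact: mem_head.
- apply: Qgen_incl; do 2![rewrite in_cons; apply/orP; right]; exact: mem_head.
Qed.

(* R = Q[t^2, t^3, z, z^-1], a subring of Q[t, z, z^-1] by [cusp_sub_laurent]. *)
Record cuspRing := CuspRing {
  cusp_val : Qtz;
  cusp_valP : cusp_val \in Qgen cusp_gens }.
HB.instance Definition _ := [isSub for cusp_val].
HB.instance Definition _ := [Choice of cuspRing by <:].
HB.instance Definition _ := [SubChoice_isSubComNzRing of cuspRing by <:].

Lemma cusp_t2 : tF ^+ 2 \in Qgen cusp_gens.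
Proof. by apply: Qgen_incl; exact: mem_head. Qed.

Lemma cusp_t3 : tF ^+ 3 \in Qgen cusp_gens.
Proof.
by apply: Qgen_incl; rewrite in_cons; apply/orP; right; exact: mem_head.
Qed.

Lemma cusp_z : zF \in Qgen cusp_gens.
Proof.
apply: Qgen_incl; do 2![rewrite in_cons; apply/orP; right]; exact: mem_head.
Qed.

Lemma cusp_zV : zF^-1 \in Qgen cusp_gens.
Proof.
apply: Qgen_incl; do 3![rewrite in_cons; apply/orP; right]; exact: mem_head.
Qed.

Lemma cusp_t4 : tF ^+ 4 \in Qgen cusp_gens.
Proof. rewrite (exprD tF 2 2); apply: rpredM; exact: cusp_t2. Qed.

Lemma cusp_t5 : tF ^+ 5 \in Qgen cusp_gens.
Proof.
rewrite (exprD tF 2 3); apply: rpredM; [exact: cusp_t2 | exact: cusp_t3].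
Qed.

Definition t2 : cuspRing := CuspRing cusp_t2.
Definition t3 : cuspRing := CuspRing cusp_t3.
Definition t4 : cuspRing := CuspRing cusp_t4.
Definition t5 : cuspRing := CuspRing cusp_t5.
Definition z : cuspRing := CuspRing cusp_z.
Definition zV : cuspRing := CuspRing cusp_zV.

Definition st2 : {poly cuspRing} := t2%:P * 'X^2.
Definition st3 : {poly cuspRing} := t3%:P * 'X^3.
Definition st4 : {poly cuspRing} := t4%:P * 'X^4.
Definition st5 : {poly cuspRing} := t5%:P * 'X^5.

(* Since st is not in R[s], the lower left entry is multiplied out; its
   factored form over Q(t, z)[s] is recovered in [mxA_val]. *)
Definition mxA : 'M[{poly cuspRing}]_2 :=
  mx_of_rows 2
    [:: [:: 1 - (1 - zV%:P) * st4; (z%:P - 1) * (st2 - st3)];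
        [:: (1 - zV%:P) * (st2 + st3 + st4 + st5); 1 + (z%:P - 1) * st4]].

Lemma mxA_map (A B : comNzRingType) (f : {rmorphism A -> B}) (s t z zV : B)
    (a2 a3 a4 a5 b bV : A) :
  f a2 = s ^+ 2 * t ^+ 2 -> f a3 = s ^+ 3 * t ^+ 3 ->
  f a4 = s ^+ 4 * t ^+ 4 -> f a5 = s ^+ 5 * t ^+ 5 -> f b = z -> f bV = zV ->
  map_mx f (mx_of_rows 2
    [:: [:: 1 - (1 - bV) * a4; (b - 1) * (a2 - a3)];
        [:: (1 - bV) * (a2 + a3 + a4 + a5); 1 + (b - 1) * a4]]) =
  mx_of_rows 2
    [:: [:: 1 - (1 - zV) * s ^+ 4 * t ^+ 4;
            (z - 1) * (s ^+ 2 * t ^+ 2 - s ^+ 3 * t ^+ 3)];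
        [:: (1 - zV) * (s ^+ 2 * t ^+ 2)
              * (1 + s * t + s ^+ 2 * t ^+ 2 + s ^+ 3 * t ^+ 3);
            1 + (z - 1) * (s ^+ 4 * t ^+ 4)]].
Proof.
move=> f2 f3 f4 f5 fb fbV; apply/matrixP => i j; rewrite !mxE.
case: i => [[|[|[]]]] // ?; case: j => [[|[|[]]]] // ? /=;
  rewrite ?(rmorphB, rmorphD, rmorphM, rmorph1) ?(f2, f3, f4, f5, fb, fbV);
  ring.
Qed.

Lemma mxA_val (s := 'X : {poly Qtz}) (t := tF%:P) (z := zF%:P)
    (zV := (zF^-1)%:P) :
  map_mx (map_poly val) mxA =
  mx_of_rows 2
    [:: [:: 1 - (1 - zV) * s ^+ 4 * t ^+ 4;
            (z - 1) * (s ^+ 2 * t ^+ 2 - s ^+ 3 * t ^+ 3)];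
        [:: (1 - zV) * (s ^+ 2 * t ^+ 2)
              * (1 + s * t + s ^+ 2 * t ^+ 2 + s ^+ 3 * t ^+ 3);
            1 + (z - 1) * (s ^+ 4 * t ^+ 4)]].
Proof.
have [v vE] : exists v : {rmorphism cuspRing -> Qtz}, cusp_val =1 v.
  by exists val.
have vst (a : cuspRing) k : cusp_val a = tF ^+ k ->
    map_poly v (a%:P * 'X^k) = s ^+ k * t ^+ k.
  move=> va; rewrite rmorphM /= map_polyXn map_polyC /= mulrC.
  by rewrite -vE va rmorphXn.
have v2 : map_poly v st2 = s ^+ 2 * t ^+ 2 by exact: vst.
have v3 : map_poly v st3 = s ^+ 3 * t ^+ 3 by exact: vst.
have v4 : map_poly v st4 = s ^+ 4 * t ^+ 4 by exact: vst.
have v5 : map_poly v st5 = s ^+ 5 * t ^+ 5 by exact: vst.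
have vz : map_poly v (Defs.z%:P) = z by rewrite map_polyC /= -vE.
have vzV : map_poly v (Defs.zV%:P) = zV.
  rewrite map_polyC; congr polyC; apply: etrans (esym (vE _)) _.
  by rewrite /Defs.zV [LHS]/=.
have -> : map_mx (map_poly val) mxA = map_mx (map_poly v) mxA.
  by apply: eq_map_mx => p; apply: eq_map_poly.
exact: mxA_map v2 v3 v4 v5 vz vzV.
Qed.

Definition mxN : 'M[cuspRing]_10 :=
  mx_of_rows 10
    [:: [:: 0; 0; 0; (1 - z) * t2; 0; (1 - z) * (- t3); (1 - zV) * t4; 0; 0; 0];
        [:: 0; 0; (zV - 1) * t2; 0; (zV - 1) * t3; 0; (zV - 1) * t4;
            (1 - z) * t4; (zV - 1) * t5; 0];
        [:: 1; 0; 0; 0; 0; 0; 0; 0; 0; 0];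
        [:: 0; 1; 0; 0; 0; 0; 0; 0; 0; 0];
        [:: 0; 0; 1; 0; 0; 0; 0; 0; 0; 0];
        [:: 0; 0; 0; 1; 0; 0; 0; 0; 0; 0];
        [:: 0; 0; 0; 0; 1; 0; 0; 0; 0; 0];
        [:: 0; 0; 0; 0; 0; 1; 0; 0; 0; 0];
        [:: 0; 0; 0; 0; 0; 0; 1; 0; 0; 0];
        [:: 0; 0; 0; 0; 0; 0; 0; 1; 0; 0]].

(* Main.v *)
From HB Require Import structures.
From mathcomp Require Import all_boot all_order all_algebra.
From mathcomp Require Import perm boolp ring.
Require Import Defs.

(** A single invariant, with values in a quotient of Q(t, z), separates both
    matrices from zero.  It detects the part of SK_1(R) that comes from the
    differentials of Q[z, z^-1]: the normalization Q[t, z, z^-1] has t * dz,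
    and the cusp has not.

    The cocycle.  Put s = 1, so that everything lives in F = Q(t, z), and let
    D = d/dz and E = d/dt.  The coefficient of dz dt in
    tr (x^-1 dx /\ dy y^-1) is, up to a coboundary,
    c(x, y) = tr (x^-1 D(x) E(y) y^-1), a 2-cocycle on GL_n(F)
    ([dlog_cocycle]); it is the Dennis trace on K_2(F).

    The cochain.  Let O be the ring of the fractions whose degree in t is at
    most 0 and let m be its maximal ideal, the fractions that vanish at
    t = infinity.  Modulo m the cocycle is a coboundary, because on a symbol
    {a, b} it takes the value (D a / a) (E b / b), where D a / a lies in O and
    E b / b in m.  The cochain is explicit: each x in GL_n(F) is a product k b
    with k in GL_n(O) and b triangular (Iwasawa), and Psi(x) = c(k, b) mod m
    ([polar_part]).  It does not depend on the decomposition, as c takes its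
    values in m on pairs of integral and on pairs of triangular matrices
    ([iwasawa_uniq]).  The identity Psi(xy) = Psi(x) + Psi(y) + c(x, y)
    ([polar_partM]) has to be checked for x in a generating set only.  It is
    formal for x in GL_n(O), and for x = diag(1, .., t, .., 1) it follows from
    an explicit Iwasawa decomposition of x k ([neutral_scale_at]); an LUP
    decomposition reduces all of GL_n(F) to these.  That the polynomials in t
    which vanish at infinity are zero is what makes Psi a useful invariant.

    The class over R.  Let L = Q[t, z, z^-1].  Elements x of R satisfy
    D x in L and E x in t L, so c(x, y) lies in t L for x, y in GL_n(R).
    Modulo t L + m, Psi is therefore a homomorphism on GL_n(R), and it kills
    the elementary matrices since Psi of a transvection is 0
    ([polar_class_El]).

    Part (1).  At s = 1 the matrix is the commutator of
    M = (1 - t, - t^2; t^2, 1 + t + t^2 + t^3) and diag(z, 1).  The matrix M is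
    a product of transvections over Q(t), on which D vanishes, and the cocycle
    identity gives Psi = (1 + t + t^2 - t^3) / z ([cusp_symbol]).  Its value
    at t = 0 is 1 / z, so it is not in t L, hence not in t L + m
    ([cusp_symbol_neq0]).

    Part (2).  Send (P, f) to the class of Psi(1 - W) modulo t L + m, where W
    is the matrix of f on a free module of which P is a retract
    ([nil_polar]).  Two retracts give matrices u v and v u, and 1 - u v and
    1 - v u have the same class ([polar_class_swap]); an exact sequence gives
    a block triangular matrix, on which Psi is additive
    ([polar_part_block]); and f = 0 gives Psi(1) = 0.  So this is an invariant
    on Nil_0(R).  The 10 x 10 matrix N is the companion matrix of the matrix
    A(s) of part (1): 1 - s N is a unipotent matrix times a block triangular
    one with diagonal blocks A(s) and a unipotent matrix
    ([companion_split]).  Hence N has the same invariant as A, and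
    det (1 - s N) = 1, which makes N nilpotent. *)

Set Implicit Arguments.
Unset Strict Implicit.
Unset Printing Implicit Defensive.

Import GRing.Theory.
Local Open Scope ring_scope.

(** * Matrices over a field *)

Section MatrixLemmas.

Variable F : fieldType.

Lemma invmxM n (x y : 'M[F]_n) : x \in unitmx -> y \in unitmx ->
  invmx (x *m y) = invmx y *m invmx x.
Proof.
move=> Ux Uy; apply: (can_inj (mulKmx (etrans (unitmx_mul x y) _))).
  by rewrite Ux Uy.
by rewrite mulmxV ?unitmx_mul ?Ux // mulmxA mulmxK // mulmxV.
Qed.

Lemma invmx_uniq n (x y : 'M[F]_n) : x *m y = 1%:M -> invmx x = y.
Proof. by move=> xy; have [Ux _] := mulmx1_unit xy; rewrite -(mulKmx Ux y) xy mulmx1. Qed.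

Lemma invmx_diag n (d : 'rV[F]_n) : (forall i, d 0 i != 0) ->
  invmx (diag_mx d) = diag_mx (\row_i (d 0 i)^-1).
Proof.
move=> d0; apply: invmx_uniq; rewrite mulmx_diag -diag_const_mx; congr diag_mx.
by apply/rowP => j; rewrite !mxE mulfV.
Qed.

Lemma unitmx_diag n (d : 'rV[F]_n) :
  (forall i, d 0 i != 0) -> diag_mx d \in unitmx.
Proof.
by move=> d0; rewrite unitmxE det_diag unitfE; apply/prodf_neq0 => i _.
Qed.

Lemma unitmx_block_trig n m (x : 'M[F]_n) (y : 'M[F]_m) z :
  x \in unitmx -> y \in unitmx -> block_mx x 0 z y \in unitmx /\
  invmx (block_mx x 0 z y) = block_mx (invmx x) 0 (- invmx y *m z *m invmx x) (invmx y).
Proof.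
move=> Ux Uy.
suff e : block_mx x 0 z y *m
    block_mx (invmx x) 0 (- invmx y *m z *m invmx x) (invmx y) = 1%:M.
  by split; [case: (mulmx1_unit e) | exact: invmx_uniq].
rewrite mulmx_block !mulmx0 !mul0mx !addr0 add0r !mulmxV // !mulmxA mulmxN mulmxV //.
by rewrite mulNmx mul1mx mulNmx subrr -scalar_mx_block.
Qed.

Lemma is_trig_mulmx n (x y : 'M[F]_n) :
  is_trig_mx x -> is_trig_mx y -> is_trig_mx (x *m y).
Proof.
move=> /is_trig_mxP Tx /is_trig_mxP Ty; apply/is_trig_mxP => i j ij.
rewrite mxE big1 // => l _; have [il|li] := ltnP i l.
  by rewrite Tx ?mul0r.
by rewrite Ty ?mulr0 // (leq_ltn_trans li).
Qed.

Lemma trig_mul_diag n (x y : 'M[F]_n) i :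
  is_trig_mx x -> is_trig_mx y -> (x *m y) i i = x i i * y i i.
Proof.
move=> /is_trig_mxP Tx /is_trig_mxP Ty; rewrite mxE (bigD1 i) //= big1 ?addr0 //.
move=> l li; have [il|il|/val_inj il] := ltngtP i l.
- by rewrite Tx ?mul0r.
- by rewrite Ty ?mulr0.
by rewrite il eqxx in li.
Qed.

Lemma is_trig_mxD n (x y : 'M[F]_n) :
  is_trig_mx x -> is_trig_mx y -> is_trig_mx (x + y).
Proof.
move=> /is_trig_mxP Tx /is_trig_mxP Ty; apply/is_trig_mxP => i j ij.
by rewrite mxE Tx ?Ty ?addr0.
Qed.

Lemma is_trig_mxN n (x : 'M[F]_n) : is_trig_mx x -> is_trig_mx (- x).
Proof.
by move=> /is_trig_mxP Tx; apply/is_trig_mxP => i j ij; rewrite mxE Tx ?oppr0.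
Qed.

End MatrixLemmas.

Section Leibniz.

Variables (F : fieldType) (d : {additive F -> F}).
Hypothesis dM : forall x y, d (x * y) = d x * y + x * d y.

Lemma leibniz1 : d 1 = 0.
Proof.
by have /eqP := dM 1 1; rewrite !mul1r mulr1 -subr_eq0 opprD addNKr oppr_eq0
  => /eqP.
Qed.

Lemma leibniz_mx n m p (x : 'M_(n, m)) (y : 'M_(m, p)) :
  map_mx d (x *m y) = map_mx d x *m y + x *m map_mx d y.
Proof.
apply/matrixP => i j; rewrite !mxE raddf_sum -big_split /=.
by apply: eq_bigr => l _; rewrite dM !mxE.
Qed.

Lemma leibniz_mx1 n : map_mx d (1%:M : 'M_n) = 0.
Proof.
by apply/matrixP => i j; rewrite !mxE; case: eqP; rewrite ?leibniz1 ?raddf0.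
Qed.

End Leibniz.

(** * Two derivations and a valuation *)

(** The model is the field of fractions of a polynomial ring in [vpar], with
    [vring] the fractions bounded at [vpar] = infinity, [dB] the derivative in
    [vpar], and [dA] a derivation of the coefficients.  The two last fields say
    how logarithmic derivatives grow at infinity. *)
Record biderField (F : fieldType) := BiderField {
  vring : subringClosed F;
  vpar : F;
  dA : {additive F -> F};
  dB : {additive F -> F};
  dA_mul : forall x y, dA (x * y) = dA x * y + x * dA y;
  dB_mul : forall x y, dB (x * y) = dB x * y + x * dB y;
  dA_vpar : dA vpar = 0;
  vparV : vpar^-1 \in vring;
  vparN : vpar \notin vring;
  vring_val : forall x, x != 0 -> exists a b : nat,
    let u := x * vpar ^+ a / vpar ^+ b in (u \in vring) && (u^-1 \in vring);
  dA_log : forall x, dA x / x \in vring;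
  dB_log : forall x, vpar * (dB x / x) \in vring }.

Section Cochain.

Variables (F : fieldType) (V : biderField F).

Local Notation O := (vring V).
Local Notation t := (vpar V).
Local Notation D := (dA V).
Local Notation E := (dB V).
Local Notation Dm := (map_mx (dA V)).
Local Notation Em := (map_mx (dB V)).

Let DM := leibniz_mx (@dA_mul F V).
Let EM := leibniz_mx (@dB_mul F V).

Lemma vpar_neq0 : t != 0.
Proof. by apply: contraNneq (vparN V) => ->; rewrite rpred0. Qed.

(** The maximal ideal of [vring]; [vpar]^-1 generates it. *)
Definition vmax : {pred F} := fun x => t * x \in O.

Lemma vmaxE x : (x \in vmax) = (t * x \in O). Proof. by []. Qed.

Lemma vmax_zmod : zmod_closed vmax.
Proof.
split=> [|x y]; rewrite !vmaxE ?mulr0 ?rpred0 // mulrBr.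
exact: rpredB.
Qed.

HB.instance Definition _ := GRing.isZmodClosed.Build F vmax vmax_zmod.

Lemma vmaxMl x y : x \in O -> y \in vmax -> x * y \in vmax.
Proof. by rewrite !vmaxE mulrCA => xO yO; apply: rpredM. Qed.

Lemma vmaxMr x y : x \in vmax -> y \in O -> x * y \in vmax.
Proof. by move=> xm yO; rewrite mulrC; apply: vmaxMl. Qed.

Lemma vmax1 : 1 \notin vmax.
Proof. by rewrite vmaxE mulr1 vparN. Qed.

Lemma vring_cases x : x \in vmax \/ x^-1 \in O.
Proof.
have [->|x0] := eqVneq x 0; first by left; rewrite rpred0.
have [a [b /andP[]]] := vring_val V x0; set u := _ / _ => uO uVO.
have t0 := vpar_neq0.
have def_x : x = u * t ^+ b / t ^+ a.
  by rewrite /u mulfVK ?expf_neq0 // mulfK ?expf_neq0.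
have [ab|ba] := leqP a b; [right|left].
  rewrite def_x -mulrA -expfB_cond ?(negPf t0) //.
  by rewrite invfM rpredM // -exprVn rpredX // vparV.
rewrite vmaxE def_x.
have -> : t * (u * t ^+ b / t ^+ a) = u * t^-1 ^+ (a - b.+1).
  rewrite exprVn -{1}(subnK ba) exprD exprS.
  by field; rewrite !expf_neq0 t0.
by rewrite rpredM // rpredX // vparV.
Qed.

Lemma dA_vring x : x \in O -> D x \in O.
Proof.
move=> xO; have [->|x0] := eqVneq x 0; first by rewrite raddf0 rpred0.
by rewrite -(divfK x0 (D x)) rpredM // dA_log.
Qed.

Lemma dB_vring x : x \in O -> E x \in vmax.
Proof.
move=> xO; have [->|x0] := eqVneq x 0; first by rewrite raddf0 rpred0.
by rewrite -(divfK x0 (E x)) vmaxMr // vmaxE dB_log.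
Qed.

(** * The logarithmic cocycle *)

(** The dz dt part of the symbol map on K_2, which sends {a, b} to
    (da / a) /\ (db / b), for the derivations [dA] along z and [dB] along t. *)
Definition dlog_cocycle n (x y : 'M[F]_n) : F :=
  \tr (invmx x *m Dm x *m (Em y *m invmx y)).

Local Notation c := dlog_cocycle.

Lemma dlog_cocycleP n (x y z : 'M[F]_n) :
  x \in unitmx -> y \in unitmx -> z \in unitmx ->
  c x y + c (x *m y) z = c x (y *m z) + c y z.
Proof.
move=> Ux Uy Uz; rewrite /c DM EM.
rewrite !invmxM // !mulmxDr !mulmxDl !mulmxDr !mxtraceD -!addrA; congr (_ + _).
  by rewrite !mulmxA mulmxK.
congr (_ + _).
  by rewrite [RHS]mxtrace_mulC -!mulmxA [RHS]mxtrace_mulC -!mulmxA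
     [RHS]mxtrace_mulC -!mulmxA [RHS]mxtrace_mulC -!mulmxA.
by rewrite !mulmxA mulmxKV.
Qed.

Lemma dlog_cocycle0l n (x y : 'M[F]_n) : Dm x = 0 -> c x y = 0.
Proof. by move=> Dx; rewrite /c Dx mulmx0 mul0mx mxtrace0. Qed.

Lemma dlog_cocycle0r n (x y : 'M[F]_n) : Em y = 0 -> c x y = 0.
Proof. by move=> Ey; rewrite /c Ey mul0mx mulmx0 mxtrace0. Qed.

Definition integral n (k : 'M[F]_n) :=
  [&& k \in unitmx, k \is a mxOver O & invmx k \is a mxOver O].

(** Triangularity of the inverse is part of the definition, so that these
    matrices visibly form a group; they are lower triangular. *)
Definition trigonal n (b : 'M[F]_n) :=
  [&& b \in unitmx, is_trig_mx b & is_trig_mx (invmx b)].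

Lemma is_trig_map_mx n (d : {additive F -> F}) (x : 'M_n) :
  is_trig_mx x -> is_trig_mx (map_mx d x).
Proof.
by move=> /is_trig_mxP Tx; apply/is_trig_mxP => i j ij; rewrite mxE Tx ?raddf0.
Qed.

Lemma integral1 n : integral (1%:M : 'M_n).
Proof. by rewrite /integral unitmx1 invmx1 !mxOver_scalar ?rpred0 ?rpred1. Qed.

Lemma integralV n (k : 'M_n) : integral k -> integral (invmx k).
Proof. by case/and3P=> Uk Ok OkV; rewrite /integral unitmx_inv Uk invmxK OkV. Qed.

Lemma integralM n (k l : 'M_n) : integral k -> integral l -> integral (k *m l).
Proof.
case/and3P=> Uk Ok OkV /and3P[Ul Ol OlV].
by rewrite /integral unitmx_mul Uk Ul invmxM // !mxOverM.
Qed.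

Lemma trigonal1 n : trigonal (1%:M : 'M_n).
Proof. by rewrite /trigonal unitmx1 invmx1 scalar_mx_is_trig. Qed.

Lemma trigonalV n (b : 'M_n) : trigonal b -> trigonal (invmx b).
Proof. by case/and3P=> Ub Tb TbV; rewrite /trigonal unitmx_inv Ub invmxK TbV. Qed.

Lemma trigonalM n (a b : 'M_n) : trigonal a -> trigonal b -> trigonal (a *m b).
Proof.
case/and3P=> Ua Ta TaV /and3P[Ub Tb TbV].
by rewrite /trigonal unitmx_mul Ua Ub invmxM // !is_trig_mulmx.
Qed.

Lemma mxOver_det n (x : 'M_n) : x \is a mxOver O -> \det x \in O.
Proof.
move=> /mxOverP Ox; apply: rpred_sum => s _.
by rewrite rpredM ?rpredX ?rpredN ?rpred1 // rpred_prod.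
Qed.

Lemma integral_det n (k : 'M_n) :
  k \is a mxOver O -> k \in unitmx -> (\det k)^-1 \in O -> integral k.
Proof.
move=> Ok Uk OdV; rewrite /integral Uk Ok /invmx Uk mxOverZ //.
apply/mxOverP => i j; rewrite mxE /cofactor.
rewrite rpredM ?rpredX ?rpredN ?rpred1 // mxOver_det //.
by apply/mxOverP => l m; rewrite !mxE (mxOverP Ok).
Qed.

Lemma integral_detV n (k : 'M_n) : integral k -> (\det k)^-1 \in O.
Proof. by case/and3P=> Uk Ok OkV; rewrite -det_inv mxOver_det. Qed.

Lemma dlog_cocycle_integral n (k l : 'M_n) :
  integral k -> integral l -> c k l \in vmax.
Proof.
case/and3P=> Uk /mxOverP Ok /mxOverP OkV /and3P[Ul /mxOverP Ol /mxOverP OlV].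
apply: rpred_sum => i _; rewrite mxE; apply: rpred_sum => j _.
rewrite vmaxMl //.
  by rewrite mxE rpred_sum // => m _; rewrite mxE rpredM ?dA_vring.
by rewrite mxE rpred_sum // => m _; rewrite mxE vmaxMr ?dB_vring.
Qed.

Lemma trigonal_diag n (b : 'M_n) i : trigonal b -> invmx b i i = (b i i)^-1.
Proof.
case/and3P=> Ub Tb TbV; have := trig_mul_diag i Tb TbV.
rewrite mulmxV // mxE eqxx => bb.
have b0 : b i i != 0.
  by apply: contra_eq_neq bb => ->; rewrite mul0r oner_neq0.
by apply: (mulfI b0); rewrite -bb mulfV.
Qed.

(** Only the diagonals contribute, by products of a logarithmic derivative for
    [dA], which is bounded, and one for [dB], which vanishes at infinity. *)
Lemma dlog_cocycle_trigonal n (a b : 'M_n) :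
  trigonal a -> trigonal b -> c a b \in vmax.
Proof.
move=> Ba Bb; have [/and3P[Ua Ta TaV] /and3P[Ub Tb TbV]] := (Ba, Bb).
apply: rpred_sum => i _; rewrite !trig_mul_diag ?is_trig_mulmx ?is_trig_map_mx //.
rewrite !trigonal_diag // ![map_mx _ _ _ _]mxE mulrC [_ * D _]mulrC.
by rewrite vmaxMr ?dA_log // vmaxE dB_log.
Qed.

(** The two decompositions differ by a matrix that is both integral and
    triangular, and the cocycle identity turns the difference into values of
    the cocycle on pairs of integral and pairs of triangular matrices. *)
Lemma iwasawa_uniq n (k l a b : 'M_n) :
  integral k -> integral l -> trigonal a -> trigonal b ->
  k *m a = l *m b -> c k a - c l b \in vmax.
Proof.
move=> Kk Kl Ba Bb kalb.
have [/and3P[Uk _ _] /and3P[Ul _ _]] := (Kk, Kl).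
have [/and3P[Ua _ _] /and3P[Ub _ _]] := (Ba, Bb).
pose q := invmx k *m l.
have qE : q = a *m invmx b.
  by rewrite /q -[l](mulmxK Ub) -kalb -mulmxA mulKmx.
have Kq : integral q by rewrite integralM ?integralV.
have Bq : trigonal q by rewrite qE trigonalM ?trigonalV.
have Uq : q \in unitmx by case/and3P: Kq.
have := dlog_cocycleP Uk Uq Ub.
have -> : k *m q = l by rewrite /q mulKVmx.
have -> : q *m b = a by rewrite qE mulmxKV.
move=> kq.
have -> : c k a - c l b = c k q - c q b.
  by apply/eqP; rewrite subr_eq addrAC eq_sym subr_eq kq.
by apply: rpredB; [exact: dlog_cocycle_integral | exact: dlog_cocycle_trigonal].
Qed.

(** * A cochain with this coboundary *)

(** Writing Psi(k b) for c(k, b), this says that Psi(x y) = v + Psi(y) + c(x, y)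
    modulo [vmax] for all y = k b, and that x y has an Iwasawa decomposition
    when y has one.  It is closed under products in x, so that the coboundary
    property of Psi can be proved on generators. *)
Definition is_primitive n (x : 'M[F]_n) (v : F) := forall k b : 'M_n,
  integral k -> trigonal b -> exists k' b' : 'M_n,
    [/\ integral k', trigonal b', x *m k *m b = k' *m b' &
        c k' b' - (v + c x (k *m b) + c k b) \in vmax].

Definition neutral n (x : 'M_n) := x \in unitmx /\ is_primitive x 0.

Lemma is_primitiveM n (x y : 'M_n) v w :
  x \in unitmx -> y \in unitmx -> is_primitive x v -> is_primitive y w ->
  is_primitive (x *m y) (v + w + c x y).
Proof.
move=> Ux Uy Px Py k b Kk Bb.
have [Uk Ub] : k \in unitmx /\ b \in unitmx by case/and3P: Kk; case/and3P: Bb.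
have [k1 [b1 [Kk1 Bb1 e1 c1]]] := Py k b Kk Bb.
have [k2 [b2 [Kk2 Bb2 e2 c2]]] := Px k1 b1 Kk1 Bb1.
exists k2, b2; split=> //; first by rewrite -e2 -[RHS]mulmxA -e1 !mulmxA.
have Ukb : k *m b \in unitmx by rewrite unitmx_mul Uk.
have := dlog_cocycleP Ux Uy Ukb; rewrite mulmxA e1 => cE.
have -> : c k2 b2 - (v + w + c x y + c (x *m y) (k *m b) + c k b) =
  (c k2 b2 - (v + c x (k1 *m b1) + c k1 b1))
  + (c k1 b1 - (w + c y (k *m b) + c k b)).
  by rewrite -[v + w + _ + _]addrA cE; ring.
exact: rpredD.
Qed.

Lemma neutralM n (x y : 'M_n) :
  c x y \in vmax -> neutral x -> neutral y -> neutral (x *m y).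
Proof.
move=> cm [Ux Px] [Uy Py]; split=> [|k b Kk Bb]; first by rewrite unitmx_mul Ux.
have [k' [b' [Kk' Bb' e c']]] := is_primitiveM Ux Uy Px Py Kk Bb.
exists k', b'; split=> //.
rewrite -[X in X \in _](subrK (c x y)) rpredD //.
by rewrite (_ : _ - _ - _ = c k' b' - (0 + 0 + c x y + c (x *m y) (k *m b)
  + c k b)) //; ring.
Qed.

Lemma neutral_integral n (x : 'M_n) : integral x -> neutral x.
Proof.
move=> Kx; have Ux : x \in unitmx by case/and3P: Kx.
split=> // k b Kk Bb; exists (x *m k), b; split=> //; first exact: integralM.
have [Uk Ub] : k \in unitmx /\ b \in unitmx by case/and3P: Kk; case/and3P: Bb.
rewrite add0r -dlog_cocycleP // opprD addrA [_ - c x k]addrC addrK rpredN.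
exact: dlog_cocycle_integral.
Qed.

Lemma integral_row_unit n (k : 'M_n) i :
  integral k -> exists j, k i j \notin vmax.
Proof.
case/and3P=> Uk /mxOverP Ok /mxOverP OkV.
case: (pickP (fun j => k i j \notin vmax)) => [j ?|none]; first by exists j.
have /negP[] := vmax1; have <- : (k *m invmx k) i i = 1.
  by rewrite mulmxV // mxE eqxx.
rewrite mxE rpred_sum // => j _; rewrite vmaxMr //.
exact: negbFE (none j).
Qed.

Definition scale_at n (i : 'I_n) : 'M[F]_n :=
  diag_mx (\row_l (if l == i then t else 1)).

Lemma det_scale_at n (i : 'I_n) : \det (scale_at i) = t.
Proof.
rewrite det_diag (bigD1 i) //= big1 ?mulr1 ?mxE ?eqxx // => j ji.
by rewrite mxE (negPf ji).
Qed.

Lemma unitmx_scale_at n (i : 'I_n) : scale_at i \in unitmx.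
Proof. by rewrite unitmxE det_scale_at unitfE vpar_neq0. Qed.

Lemma D_scale_at n (i : 'I_n) : Dm (scale_at i) = 0.
Proof.
apply/matrixP => a b; rewrite !mxE raddfMn /=.
by case: ifP => _; rewrite ?dA_vpar ?(leibniz1 (@dA_mul F V)) mul0rn.
Qed.

Lemma trigonal_diag_mx n (d : 'rV_n) :
  (forall i, d 0 i != 0) -> trigonal (diag_mx d).
Proof.
by move=> d0; rewrite /trigonal unitmx_diag // invmx_diag // !diag_mx_is_trig.
Qed.

Lemma dlog_cocycle_diag n (k : 'M_n) (d : 'rV_n) :
  integral k -> (forall i, d 0 i != 0) -> c k (diag_mx d) \in vmax.
Proof.
case/and3P=> Uk /mxOverP Ok /mxOverP OkV d0; rewrite /c invmx_diag //.
apply: rpred_sum => a _; rewrite mul_mx_diag mxE; apply: rpred_sum => b _.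
rewrite vmaxMl //; first by rewrite mxE rpred_sum // => m _; rewrite mxE rpredM ?dA_vring.
rewrite !mxE; have [->|_] := eqVneq b a; last by rewrite mulr0n raddf0 mul0r rpred0.
by rewrite mulr1n vmaxE dB_log.
Qed.

Lemma scale_at_neq0 n (i j : 'I_n) :
  (\row_l (if l == i then t else 1)) 0 j != 0.
Proof. by rewrite mxE; case: ifP => _; rewrite ?oner_neq0 ?vpar_neq0. Qed.

(** The only generator for which the existence of an Iwasawa decomposition is
    not formal.  Let j be the last index at which row i of k has a unit; a
    triangular integral q clears the entries of that row before j, and those
    after j are in the maximal ideal, so scaling row i by t and column j by
    t^-1 keeps k q integral, with the same determinant.  All the cocycle terms
    vanish modulo [vmax] since the scalings are killed by [dA]. *)
Lemma neutral_scale_at n (i : 'I_n) : neutral (scale_at i).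
Proof.
set x := scale_at i; have Ux : x \in unitmx by exact: unitmx_scale_at.
split=> // k b Kk Bb; have [/and3P[Uk Ok _] /and3P[Ub _ _]] := (Kk, Bb).
have [j0 j0P] := integral_row_unit i Kk.
have [j kij jmax] := @arg_maxnP _ j0 (fun j => k i j \notin vmax) val j0P.
have kj0 : k i j != 0 by apply: contraNneq kij => ->; rewrite rpred0.
have OkjV : (k i j)^-1 \in O.
  by case: (vring_cases (k i j)) => // km; rewrite km in kij.
pose r : 'rV[F]_n := \row_l (if (l < j)%N then k i l / k i j else 0).
pose e : 'cV[F]_n := delta_mx j 0.
have re : r *m e = 0.
  by apply/matrixP => a a'; rewrite /e -colE !mxE ltnn.
have er2 : e *m r *m (e *m r) = 0.
  by rewrite mulmxA -[e *m r *m e]mulmxA re mulmx0 mul0mx.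
have Oer : e *m r \is a mxOver O.
  apply/mxOverP => a a'; rewrite !mxE big_ord1 !mxE.
  case: (a == j) => /=; last by rewrite mul0r rpred0.
  by rewrite mul1r; case: ifP; rewrite ?rpred0 // rpredM // (mxOverP Ok).
have Ter : is_trig_mx (e *m r).
  apply/is_trig_mxP => a a' aa'; rewrite !mxE big_ord1 !mxE.
  have [aj|_] := eqVneq a j; last by rewrite mul0r.
  by rewrite -aj ltnNge (ltnW aa') mulr0.
pose q := 1%:M - e *m r.
have qV : q *m (1%:M + e *m r) = 1%:M.
  by rewrite mulmxDr mulmx1 mulmxBl mul1mx er2 subr0 subrK.
have [Uq _] := mulmx1_unit qV.
have O1 : (1%:M : 'M[F]_n) \is a mxOver O by rewrite mxOver_scalar ?rpred0 ?rpred1.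
have Kq : integral q.
  by rewrite /integral Uq (invmx_uniq qV) rpredB ?rpredD.
have Bq : trigonal q.
  have T1 := scalar_mx_is_trig n (1 : F).
  by rewrite /trigonal Uq (invmx_uniq qV) !is_trig_mxD // is_trig_mxN.
have kqi l : (k *m q) i l = if (l < j)%N then 0 else k i l.
  rewrite /q mulmxBr mulmx1 mulmxA /e -colE !mxE big_ord1 !mxE.
  by case: ifP => _; rewrite ?mulr0 ?subr0 // mulrC divfK // subrr.
(* x k b = k' (y b), where k' is integral and y triangular *)
pose y := scale_at j *m invmx q.
have Uj := unitmx_scale_at j.
have UqV : invmx q \in unitmx by rewrite unitmx_inv.
have Uy : y \in unitmx by rewrite unitmx_mul Uj.
have By : trigonal y by rewrite trigonalM ?trigonalV // trigonal_diag_mx //; exact: scale_at_neq0.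
have Kkq := integralM Kk Kq; have [/and3P[Ukq /mxOverP Okq _]] := Kkq.
pose k' := x *m (k *m q) *m invmx (scale_at j).
have k'y : k' *m y = x *m k.
  by rewrite /k' /y mulmxA mulmxKV // mulmxA mulmxK.
have k'j : k' *m scale_at j = x *m (k *m q) by rewrite /k' mulmxKV.
have Uk' : k' \in unitmx by rewrite !unitmx_mul Ux Uk Uq unitmx_inv.
have Kk' : integral k'.
  apply: integral_det => //; last first.
    rewrite !det_mulmx det_inv !det_scale_at mulrC mulKf ?vpar_neq0 //.
    by rewrite -det_mulmx integral_detV.
  have rowE (f : 'I_n -> F) l : (\row_l f l) 0 l = f l by rewrite mxE.
  apply/mxOverP => a l.
  rewrite /k' invmx_diag; last exact: scale_at_neq0.
  rewrite mul_mx_diag mxE mul_diag_mx mxE !rowE.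
  have [ai|ai] := eqVneq a i; last first.
    by rewrite mul1r rpredM //; case: ifP => _; rewrite ?invr1 ?rpred1 ?vparV.
  rewrite ai; have [->|lj] := eqVneq l j.
    by rewrite mulrAC mulfV ?vpar_neq0 // mul1r.
  rewrite invr1 mulr1 kqi; case: ltnP => [_|jl]; first by rewrite mulr0 rpred0.
  rewrite -vmaxE; apply: contraNT lj => /jmax /= lj.
  by rewrite -val_eqE eqn_leq lj jl.
exists k', (y *m b); split=> //; first exact: trigonalM.
  by rewrite mulmxA k'y.
have e1 := dlog_cocycleP Uk' Uy Ub; rewrite k'y in e1.
have e2 := dlog_cocycleP Ux Uk Ub.
have e3 := dlog_cocycleP Uk' Uj UqV; rewrite k'j -/y in e3.
have e4 := dlog_cocycleP Ux Ukq UqV.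
have Dx w : c x w = 0 by rewrite dlog_cocycle0l // D_scale_at.
have Dj w : c (scale_at j) w = 0 by rewrite dlog_cocycle0l // D_scale_at.
rewrite !Dx !add0r in e2 e4; rewrite Dj addr0 e4 in e3.
have -> : c k' (y *m b) - (0 + c x (k *m b) + c k b) = c k' y - c y b.
  by rewrite Dx !add0r -e2; apply/eqP; rewrite subr_eq addrAC eq_sym subr_eq e1.
rewrite -e3; apply: rpredB; last exact: dlog_cocycle_trigonal.
apply: rpredD; first by apply: dlog_cocycle_diag => //; exact: scale_at_neq0.
by apply: dlog_cocycle_integral => //; apply: integralV.
Qed.

Lemma neutralM0 n (x y : 'M_n) :
  Dm x = 0 -> neutral x -> neutral y -> neutral (x *m y).
Proof. by move=> Dx; apply: neutralM; rewrite dlog_cocycle0l ?rpred0. Qed.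

Lemma dA_vparX m : D (t ^+ m) = 0.
Proof.
elim: m => [|m IHm]; first by rewrite (leibniz1 (@dA_mul F V)).
by rewrite exprS dA_mul IHm dA_vpar mul0r mulr0 addr0.
Qed.

Lemma dA_vparXV m : D (t ^- m) = 0.
Proof.
have tm0 := expf_neq0 m vpar_neq0; apply: (mulfI tm0); rewrite mulr0.
have := dA_mul V (t ^+ m) (t ^- m).
by rewrite mulfV // dA_vparX (leibniz1 (@dA_mul F V)) mul0r add0r.
Qed.

Lemma neutral_scalarV n : neutral (t^-1%:M : 'M_n).
Proof.
have tV0 : t^-1 != 0 by rewrite invr_eq0 vpar_neq0.
have tV0d i : (const_mx t^-1 : 'rV_n) 0 i != 0 by rewrite mxE.
set x := t^-1%:M.
have xE : x = diag_mx (const_mx t^-1) by rewrite diag_const_mx.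
have Dx w : c x w = 0.
  rewrite dlog_cocycle0l //; apply/matrixP => i j.
  by rewrite !mxE raddfMn /= -[t]expr1 dA_vparXV mul0rn.
have Ux : x \in unitmx by rewrite xE unitmx_diag.
split=> // k b Kk Bb.
have [Uk Ub] : k \in unitmx /\ b \in unitmx by case/and3P: Kk; case/and3P: Bb.
exists k, (x *m b); split=> //.
- by apply: trigonalM => //; rewrite xE; apply: trigonal_diag_mx.
- by rewrite mulmxA scalar_mxC.
have e1 := dlog_cocycleP Uk Ux Ub; have e2 := dlog_cocycleP Ux Uk Ub.
rewrite !Dx !add0r in e2; have kx : k *m x = x *m k by rewrite /x scalar_mxC.
rewrite Dx addr0 kx e2 in e1.
by rewrite Dx !add0r -e1 addrK xE dlog_cocycle_diag.
Qed.

Lemma neutral_diagX n (f : 'I_n -> nat) :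
  neutral (diag_mx (\row_i t ^+ f i)).
Proof.
have [m] := ubnP (\sum_i f i)%N; elim: m f => // m IHm f le_m.
have [f0|] := altP (@forallP _ (fun i => f i == 0)%N).
  apply: neutral_integral; rewrite (_ : diag_mx _ = 1%:M) ?integral1 //.
  rewrite -diag_const_mx; congr diag_mx; apply/rowP => i.
  by rewrite !mxE (eqP (f0 i)).
rewrite negb_forall => /existsP[i fi0].
pose g j := (f j - (j == i))%N.
have -> : diag_mx (\row_j t ^+ f j) = scale_at i *m diag_mx (\row_j t ^+ g j).
  rewrite mulmx_diag; congr diag_mx; apply/rowP => j; rewrite !mxE /g.
  have [->|_] := eqVneq j i; last by rewrite subn0 mul1r.
  by rewrite -exprS subn1 prednK // lt0n.
apply: neutralM0; [exact: D_scale_at|exact: neutral_scale_at|apply: IHm].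
rewrite -ltnS (leq_trans _ le_m) // ltnS (bigD1 i) //= [X in (_ < X)%N](bigD1 i) //=.
rewrite -addSn leq_add //; first by rewrite /g eqxx subn1 prednK // lt0n.
by apply: leq_sum => j _; apply: leq_subr.
Qed.

(** Negative powers of t on the diagonal are reached by a scalar matrix, which
    is central, and the nonnegative powers. *)
Lemma neutral_diagXV n (f : 'I_n -> nat) :
  neutral (diag_mx (\row_i t ^- f i)).
Proof.
pose M := \max_i f i; have t0 := vpar_neq0.
have -> : diag_mx (\row_i t ^- f i) =
    (t ^- M)%:M *m diag_mx (\row_i t ^+ (M - f i)) :> 'M_n.
  rewrite -diag_const_mx mulmx_diag; congr diag_mx; apply/rowP => i.
  rewrite !mxE -{1}(subnK (leq_bigmax i : f i <= M)%N) exprD invfM mulrAC.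
  by rewrite mulVf ?expf_neq0 // mul1r.
have DtV m : Dm (t ^- m)%:M = 0 :> 'M_n.
  by apply/matrixP => i j; rewrite !mxE raddfMn /= dA_vparXV mul0rn.
apply: neutralM0 (neutral_diagX _) => //.
elim: M => [|M IHM]; first by rewrite invr1; apply/neutral_integral/integral1.
rewrite -exprVn exprS scalar_mxM exprVn; apply: neutralM0 IHM.
  by rewrite -[t]expr1 DtV.
exact: neutral_scalarV.
Qed.

Lemma vring_pole x : exists M, forall m, (M <= m)%N -> x / t ^+ m \in O.
Proof.
have [->|x0] := eqVneq x 0; first by exists 0%N => m _; rewrite mul0r rpred0.
have [a [b /andP[uO _]]] := vring_val V x0; exists b => m bm.
have t0 := vpar_neq0.
have -> : x / t ^+ m = x * t ^+ a / t ^+ b * t^-1 ^+ (a + (m - b)).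
  by rewrite exprVn -{1}(subnKC bm) !exprD; field; rewrite ?expf_neq0 ?t0.
by rewrite rpredM // rpredX // vparV.
Qed.

Lemma vring_pole_mx n (x : 'M[F]_n) :
  exists M, forall i j m, (M <= m)%N -> x i j / t ^+ m \in O.
Proof.
have [M MP] := choice (fun p : 'I_n * 'I_n => vring_pole (x p.1 p.2)).
exists (\max_p M p) => i j m le_m; apply: (MP (i, j)).
exact: leq_trans (leq_bigmax (i, j)) le_m.
Qed.

(** A strictly triangular order is encoded by a weight on the indices, which
    covers lower and upper triangular matrices and transvections alike.
    Conjugation by a diagonal matrix of large powers of t makes such a matrix
    integral. *)
Lemma neutral_unipotent n (w : 'I_n -> nat) (x : 'M_n) :
  \det x = 1 -> (forall i j, (w i <= w j)%N -> x i j = (i == j)%:R) -> neutral x.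
Proof.
move=> detx xw; have [M MP] := vring_pole_mx x; have t0 := vpar_neq0.
pose f i := (M * w i)%N.
pose d := diag_mx (\row_i t ^+ f i) : 'M[F]_n.
pose e := diag_mx (\row_i t ^- f i) : 'M[F]_n.
have de : d *m e = 1%:M.
  rewrite mulmx_diag -diag_const_mx; congr diag_mx.
  by apply/rowP => j; rewrite !mxE mulfV ?expf_neq0.
have ed := mulmx1C de.
have Ik : integral (e *m x *m d).
  apply: integral_det.
  - apply/mxOverP => i j; rewrite mul_mx_diag mxE mul_diag_mx mxE [X in X * _ * _]mxE
      [X in _ * X]mxE.
    have [ij|ij] := leqP (w i) (w j).
      rewrite xw //; case: eqP => [->|_]; last by rewrite mulr0 mul0r rpred0.
      by rewrite mulr1 mulVf ?expf_neq0 ?rpred1.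
    have -> : t ^- f i * x i j * t ^+ f j = x i j / t ^+ (f i - f j).
      have le_f : (f j <= f i)%N by rewrite leq_mul2l ltnW ?orbT.
      by rewrite -{1}(subnK le_f) exprD; field; rewrite ?expf_neq0 ?t0.
    by apply: MP; rewrite /f -mulnBr leq_pmulr // subn_gt0.
  - rewrite unitmxE !det_mulmx detx mulr1 -det_mulmx ed det1; exact: unitr1.
  - by rewrite !det_mulmx detx mulr1 -det_mulmx ed det1 invr1 rpred1.
have -> : x = d *m (e *m x *m d *m e).
  by rewrite -!mulmxA de mulmx1 !mulmxA de mul1mx.
have D0 : Dm d = 0.
  by apply/matrixP => i j; rewrite !mxE raddfMn /= dA_vparX mul0rn.
apply: neutralM0 (neutral_diagX _) _ => //.
apply: neutralM (neutral_integral Ik) (neutral_diagXV _).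
by apply: dlog_cocycle_diag => // i; rewrite mxE invr_eq0 expf_neq0.
Qed.
End Cochain.

Section PolarPart.

Variables (F : fieldType) (V : biderField F).

Local Notation O := (vring V).
Local Notation t := (vpar V).
Local Notation D := (dA V).
Local Notation E := (dB V).
Local Notation Dm := (map_mx (dA V)).
Local Notation Em := (map_mx (dB V)).
Local Notation c := (dlog_cocycle V).

(** From an LUP decomposition, in which U is a unipotent matrix times a diagonal
    one; a diagonal matrix is a unit of [vring] times a power of t in each
    entry. *)
Lemma is_primitive_exists n (x : 'M_n) :
  x \in unitmx -> exists v, is_primitive V x v.
Proof.
case: n x => [|n] x Ux.
  exists 0; have [] // := @neutral_integral F V 0 x.
  by rewrite /integral Ux !flatmxOver.
have := cormen_lup_correct x; have := cormen_lup_perm x.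
have := cormen_lup_detL x; have := cormen_lup_lower x; have := cormen_lup_upper x.
case: (cormen_lup x) => [[P L] U] /= Uu Ll Ld /is_perm_mxP[s Ps] PxLU.
have UP : P \in unitmx by rewrite Ps unitmx_perm.
have UL : L \in unitmx by rewrite unitmxE Ld unitr1.
have UU : U \in unitmx.
  have : P *m x \in unitmx by rewrite unitmx_mul UP.
  by rewrite [P *m x]PxLU [L * U](_ : _ = L *m U) // unitmx_mul UL.
have trU : is_trig_mx U^T by apply/is_trig_mxP => i j ij; rewrite mxE Uu.
have Udiag i : U i i != 0.
  move: UU; rewrite unitmxE -det_tr det_trig // unitfE => /prodf_neq0/(_ i isT).
  by rewrite mxE.
have perm_integral (p : 'S_n.+1) : integral V (perm_mx p).
  have Op (q : 'S_n.+1) : perm_mx q \is a mxOver O.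
    by apply/mxOverP => i j; rewrite !mxE; case: eqP; rewrite ?rpred0 ?rpred1.
  rewrite /integral unitmx_perm (invmx_uniq (y := perm_mx p^-1%g)) ?Op //.
  by rewrite -perm_mxM fingroup.mulgV perm_mx1.
have nP : neutral V (invmx P).
  by apply: neutral_integral; apply: integralV; rewrite Ps.
have nL : neutral V L.
  apply: (neutral_unipotent _ (w := fun i => i)) => // i j ij; exact: Ll.
pose d := \row_i U i i; have d0 i : d 0 i != 0 by rewrite mxE.
have [UU1 nU1] : neutral V (U *m invmx (diag_mx d)).
  apply: (neutral_unipotent _ (w := fun i => (n - i)%N)).
    rewrite det_mulmx det_inv det_diag -det_tr det_trig // -prodf_div big1 // => i _.
    by rewrite !mxE mulfV.
  move=> i j; rewrite leq_sub2lE -1?ltnS // => ji; rewrite invmx_diag // mul_mx_diag !mxE.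
  have [->|ij] := eqVneq i j; first by rewrite mulfV.
  by rewrite (Uu i j) ?mul0r // ltn_neqAle eq_sym ij.
have [Ud nd] : neutral V (diag_mx d).
  have t0 := vpar_neq0 V.
  have [a /choice[b ab]] := choice (fun i => vring_val V (d0 i)).
  pose u := \row_i (d 0 i * t ^+ a i / t ^+ b i).
  have u0 i : u 0 i != 0 by rewrite mxE !mulf_neq0 ?invr_eq0 ?expf_neq0.
  have -> : diag_mx d =
      diag_mx u *m (diag_mx (\row_i t ^+ b i) *m diag_mx (\row_i t ^- a i)).
    rewrite !mulmx_diag; congr diag_mx; apply/rowP => i; rewrite !mxE.
    by field; rewrite ?expf_neq0.
  have Ou i : (u 0 i \in O) && ((u 0 i)^-1 \in O) by rewrite [u 0 i]mxE; exact: ab.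
  have ku : integral V (diag_mx u).
    rewrite /integral unitmx_diag // invmx_diag // !mxOver_diag ?rpred0 //;
      apply/mxOverP => i0 i; rewrite [i0]ord1; first by rewrite mxE; case/andP: (Ou i).
    by case/andP: (Ou i).
  apply: neutralM.
  - rewrite mulmx_diag; apply: dlog_cocycle_diag => // i.
    by rewrite !mxE mulf_neq0 ?invr_eq0 ?expf_neq0.
  - exact: neutral_integral.
  apply: neutralM0; last exact: (neutral_diagXV V).
    by apply/matrixP => i j; rewrite !mxE raddfMn /= dA_vparX mul0rn.
  exact: (neutral_diagX V).
have -> : x = invmx P *m (L *m (U *m invmx (diag_mx d) *m diag_mx d)).
  rewrite mulmxKV // -[L *m U](_ : P *m x = _); first by rewrite mulKmx.
  exact: PxLU.
have [[UPV pP] [_ pL]] := (nP, nL).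
eexists; apply: is_primitiveM pP _ => //.
  by rewrite unitmx_mul UL unitmx_mul UU1.
apply: is_primitiveM pL _ => //; first by rewrite unitmx_mul UU1.
exact: is_primitiveM nU1 nd.
Qed.

(** [v] represents Psi(x), where any Iwasawa decomposition may serve by
    [iwasawa_uniq]. *)
Definition polar_part n (x : 'M_n) (v : F) := exists k b : 'M_n,
  [/\ integral V k, trigonal b, x = k *m b & v - c k b \in vmax V].

Lemma polar_part_primitive n (x : 'M_n) v : is_primitive V x v -> polar_part x v.
Proof.
move=> /(_ 1%:M 1%:M (integral1 V n) (trigonal1 F n))[k [b [Kk Bb e cv]]].
exists k, b; split=> //; first by rewrite -e !mulmx1.
have E1 : Em (1%:M : 'M_n) = 0 by exact: leibniz_mx1 (@dB_mul F V) n.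
move: cv; rewrite mulmx1 (dlog_cocycle0r _ E1) (dlog_cocycle0r _ E1).
by rewrite !addr0 -rpredN opprB.
Qed.

Lemma polar_part_exists n (x : 'M_n) : x \in unitmx -> exists v, polar_part x v.
Proof. by case/is_primitive_exists=> v /polar_part_primitive; exists v. Qed.

Lemma polar_part_uniq n (x : 'M_n) v w :
  polar_part x v -> polar_part x w -> v - w \in vmax V.
Proof.
case=> k [a [Kk Ba -> vk]] [l [b [Kl Bb kalb wl]]].
have := iwasawa_uniq Kk Kl Ba Bb kalb.
have -> : v - w = (v - c k a) + (c k a - c l b) - (w - c l b) by ring.
by move=> ca; rewrite rpredB // rpredD.
Qed.

Lemma polar_part_cong n (x : 'M_n) v w :
  v - w \in vmax V -> polar_part x v -> polar_part x w.
Proof.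
move=> vw [k [b [Kk Bb e vc]]]; exists k, b; split=> //.
by have -> : w - c k b = (v - c k b) - (v - w); [ring | exact: rpredB].
Qed.

Lemma polar_part_unit n (x : 'M_n) v : polar_part x v -> x \in unitmx.
Proof.
by case=> k [b [/and3P[Uk _ _] /and3P[Ub _ _] -> _]]; rewrite unitmx_mul Uk.
Qed.

(** The values v that [is_primitive] allows for x are those of Psi(x), as the
    choice k = b = 1 shows; so its instance for y gives the formula. *)
Lemma polar_partM n (x y : 'M_n) v w :
  polar_part x v -> polar_part y w -> polar_part (x *m y) (v + w + c x y).
Proof.
move=> xv yw; have Ux := polar_part_unit xv; have Uy := polar_part_unit yw.
have [v' pv] := is_primitive_exists Ux; have [w' pw] := is_primitive_exists Uy.
apply: polar_part_cong (polar_part_primitive (is_primitiveM Ux Uy pv pw)).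
have v'v := polar_part_uniq (polar_part_primitive pv) xv.
have w'w := polar_part_uniq (polar_part_primitive pw) yw.
have -> : v' + w' + c x y - (v + w + c x y) = (v' - v) + (w' - w) by ring.
exact: rpredD.
Qed.

Lemma polar_part_neutral n (x : 'M_n) : neutral V x -> polar_part x 0.
Proof. by case=> _ /polar_part_primitive. Qed.

Lemma polar_part_trigonal n (b : 'M_n) : trigonal b -> polar_part b 0.
Proof.
move=> Bb; exists 1%:M, b; rewrite mul1mx integral1; split=> //.
by rewrite dlog_cocycle0l ?subr0 ?rpred0 // (leibniz_mx1 (@dA_mul F V)).
Qed.

Lemma polar_part_block n m (x : 'M_n) (y : 'M_m) z v w :
  polar_part x v -> polar_part y w -> polar_part (block_mx x 0 z y) (v + w).
Proof.
case=> k [a [Kk Ba -> va]] [l [b [Kl Bb -> wb]]].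
have [/and3P[Uk Ok OkV] /and3P[Ul Ol OlV]] := (Kk, Kl).
have [/and3P[Ua Ta TaV] /and3P[Ub Tb TbV]] := (Ba, Bb).
have mxOver_block (p : 'M_n) (q : 'M_m) : p \is a mxOver O -> q \is a mxOver O ->
    block_mx p 0 0 q \is a mxOver O.
  move=> /mxOverP Op /mxOverP Oq; apply/mxOverP => i j; rewrite !mxE.
  by case: splitP => i' _; rewrite mxE; case: splitP => j' _; rewrite ?mxE ?rpred0.
have [Ukl klV] := unitmx_block_trig 0 Uk Ul; rewrite mulmx0 mul0mx in klV.
have [Uab abV] := unitmx_block_trig (invmx l *m z) Ua Ub.
exists (block_mx k 0 0 l), (block_mx a 0 (invmx l *m z) b); split.
- by rewrite /integral Ukl klV !mxOver_block.
- by rewrite /trigonal Uab abV !is_trig_block_mx // !eqxx Ta Tb TaV TbV.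
- rewrite mulmx_block !mulmx0 !mul0mx !addr0 !add0r mulKVmx //.
have -> : c (block_mx k 0 0 l) (block_mx a 0 (invmx l *m z) b) = c k a + c l b.
  rewrite /dlog_cocycle klV abV !map_block_mx !map_mx0.
  rewrite !mulmx_block !mulmx0 !mul0mx !addr0 !add0r mxtrace_block.
  by rewrite !mul0mx addr0 add0r.
have -> : v + w - (c k a + c l b) = (v - c k a) + (w - c l b) by ring.
exact: rpredD.
Qed.
End PolarPart.

(** * The class of the cochain over a subring *)

(** Over a subring S on which the cocycle takes values in T, the cochain becomes
    a homomorphism modulo T. *)
Section PolarClass.

Variables (F : fieldType) (V : biderField F) (S : subringClosed F) (T : zmodClosed F).
Local Notation c := (dlog_cocycle V).
Hypothesis mulST : forall x y, x \in S -> y \in T -> x * y \in T.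
Hypothesis dAdB_T : forall x y, x \in S -> y \in S -> dA V x * dB V y \in T.

(** The subgroup T + [vmax]. *)
Definition polar_mod : {pred F} := fun v => `[< exists2 q, q \in T & v - q \in vmax V >].

Lemma polar_mod_zmod : zmod_closed polar_mod.
Proof.
split=> [|x y]; first by apply/asboolP; exists 0; rewrite ?subr0 rpred0.
move=> /asboolP[p Tp px] /asboolP[q Tq qy]; apply/asboolP; exists (p - q).
  exact: rpredB.
by have -> : x - y - (p - q) = (x - p) - (y - q); [ring | exact: rpredB].
Qed.

HB.instance Definition _ := GRing.isZmodClosed.Build F polar_mod polar_mod_zmod.

Lemma vmax_polar_mod v : v \in vmax V -> v \in polar_mod.
Proof. by move=> mv; apply/asboolP; exists 0; rewrite ?subr0 // rpred0. Qed.

Lemma T_polar_mod v : v \in T -> v \in polar_mod.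
Proof. by move=> Tv; apply/asboolP; exists v; rewrite // subrr rpred0. Qed.

Definition GLover n (x : 'M[F]_n) :=
  [&& x \in unitmx, x \is a mxOver S & invmx x \is a mxOver S].

Lemma GLoverM n (x y : 'M_n) : GLover x -> GLover y -> GLover (x *m y).
Proof.
case/and3P=> Ux Sx SxV /and3P[Uy Sy SyV].
by rewrite /GLover unitmx_mul Ux Uy invmxM // !mxOverM.
Qed.

Lemma GLover_intro n (x y : 'M_n) :
  x *m y = 1%:M -> x \is a mxOver S -> y \is a mxOver S -> GLover x.
Proof.
by move=> xy Sx Sy; have [Ux _] := mulmx1_unit xy; rewrite /GLover Ux (invmx_uniq xy) Sx.
Qed.

Lemma mxOver1 n : (1%:M : 'M[F]_n) \is a mxOver S.
Proof. by rewrite mxOver_scalar ?rpred0 ?rpred1. Qed.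

Lemma GLover1 n : GLover (1%:M : 'M_n).
Proof. by apply: GLover_intro (mulmx1 _) _ _; exact: mxOver1. Qed.

Lemma mxOver_block n m p q (x : 'M_(n, p)) (y : 'M_(n, q)) (z : 'M_(m, p))
    (w : 'M[F]_(m, q)) :
  x \is a mxOver S -> y \is a mxOver S -> z \is a mxOver S -> w \is a mxOver S ->
  block_mx x y z w \is a mxOver S.
Proof.
move=> /mxOverP Sx /mxOverP Sy /mxOverP Sz /mxOverP Sw; apply/mxOverP => i j.
by rewrite !mxE; case: splitP => i' _; rewrite mxE; case: splitP => j' _.
Qed.

Lemma dlog_cocycle_GLover n (x y : 'M_n) : GLover x -> GLover y -> c x y \in T.
Proof.
case/and3P=> Ux /mxOverP Sx /mxOverP SxV /and3P[Uy /mxOverP Sy /mxOverP SyV].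
apply: rpred_sum => i _; rewrite mxE; apply: rpred_sum => j _.
rewrite !mxE mulr_suml; apply: rpred_sum => l _.
rewrite mulr_sumr; apply: rpred_sum => m _; rewrite !mxE.
have -> : forall p q r s : F, p * q * (r * s) = p * s * (q * r).
  by move=> p q r s; ring.
by rewrite mulST ?dAdB_T // rpredM.
Qed.

Definition polar_class n (x : 'M[F]_n) (v : F) :=
  exists2 w, polar_part V x w & v - w \in polar_mod.

Lemma polar_class_part n (x : 'M_n) v : polar_part V x v -> polar_class x v.
Proof. by exists v; rewrite // subrr rpred0. Qed.

Lemma polar_class_uniq n (x : 'M_n) v w :
  polar_class x v -> polar_class x w -> v - w \in polar_mod.
Proof.
case=> [v' xv' vv'] [w' xw' ww'].
have -> : v - w = (v - v') - (w - w') + (v' - w') by ring.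
by apply: rpredD; [exact: rpredB | exact/vmax_polar_mod/(polar_part_uniq xv')].
Qed.

Lemma polar_classM n (x y : 'M_n) v w : GLover x -> GLover y ->
  polar_class x v -> polar_class y w -> polar_class (x *m y) (v + w).
Proof.
move=> Sx Sy [v' xv' vv'] [w' yw' ww']; exists (v' + w' + c x y).
  exact: polar_partM.
have -> : v + w - (v' + w' + c x y) = (v - v') + (w - w') - c x y by ring.
by apply: rpredB; [exact: rpredD | exact/T_polar_mod/dlog_cocycle_GLover].
Qed.

Lemma polar_class_block n m (x : 'M_n) (y : 'M_m) z v w :
  polar_class x v -> polar_class y w -> polar_class (block_mx x 0 z y) (v + w).
Proof.
move=> [v' xv' vv'] [w' yw' ww']; exists (v' + w'); first exact: polar_part_block.
by have -> : v + w - (v' + w') = (v - v') + (w - w'); [ring | exact: rpredD].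
Qed.

Lemma polar_class1 n : polar_class (1%:M : 'M_n) 0.
Proof. exact/polar_class_part/polar_part_trigonal/trigonal1. Qed.

(** Both 1 - u v and 1 - v u arise from (1, u; v, 1) by multiplication with
    unipotent block matrices over S; the upper unipotent one, whose class is
    not computed, occurs once on each side and cancels. *)
Lemma polar_class_swap n m (u : 'M_(n, m)) (v : 'M_(m, n)) a :
  u \is a mxOver S -> v \is a mxOver S -> GLover (1%:M - u *m v) ->
  polar_class (1%:M - u *m v) a -> polar_class (1%:M - v *m u) a.
Proof.
move=> Su Sv Gx xa; have [/and3P[Ux Sx SxV]] := Gx.
set x := 1%:M - u *m v in Gx xa Ux Sx SxV.
pose y := 1%:M - v *m u; pose yV := 1%:M + v *m invmx x *m u.
have yyV : y *m yV = 1%:M.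
  rewrite /yV mulmxDr mulmx1 !mulmxA.
  have -> : y *m v = v *m x.
    by rewrite /x /y mulmxBl mulmxBr mul1mx mulmx1 mulmxA.
  by rewrite mulmxK // subrK.
have [Uy _] := mulmx1_unit yyV.
have [O1n O1m] := (mxOver1 n, mxOver1 m).
have Sy : y \is a mxOver S by rewrite rpredB // mxOverM.
have SyV : yV \is a mxOver S by rewrite rpredD // mxOverM // mxOverM.
have Gy : GLover y by exact: GLover_intro yyV Sy SyV.
have [b yb] : exists b, polar_class y b.
  by have [b /polar_class_part] := polar_part_exists V Uy; exists b.
have S0 p q : (0 : 'M[F]_(p, q)) \is a mxOver S by rewrite mxOver0 ?rpred0.
pose U := block_mx (1%:M : 'M_n) u 0 (1%:M : 'M_m).
pose W := block_mx (1%:M : 'M_n) 0 v (1%:M : 'M_m).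
pose X := block_mx x 0 v (1%:M : 'M_m).
pose Y := block_mx (1%:M : 'M_n) 0 0 y.
have GU : GLover U.
  apply: (@GLover_intro _ _ (block_mx 1%:M (- u) 0 1%:M)).
  - rewrite mulmx_block !mulmx0 !mul0mx !mul1mx !mulmx1 !addr0 !add0r addNr.
    by rewrite -scalar_mx_block.
  - by rewrite mxOver_block.
  - by rewrite mxOver_block // rpredN.
have trig p q (g : 'M_p) (h : 'M_q) z : z \is a mxOver S -> GLover g -> GLover h ->
    GLover (block_mx g 0 z h).
  move=> Sz /and3P[Ug Sg SgV] /and3P[Uh Sh ShV].
  have [Ugh ghV] := unitmx_block_trig z Ug Uh.
  by rewrite /GLover Ugh ghV !mxOver_block // mxOverM // mxOverM // rpredN.
have [d Ud] : exists d, polar_class U d.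
  have [|d /polar_class_part] := @polar_part_exists _ V _ U; last by exists d.
  by case/and3P: GU.
have UXWYU : U *m X = W *m (Y *m U).
  rewrite !mulmx_block !mulmx0 !mul0mx !mul1mx !mulmx1 !addr0 !add0r.
  by rewrite mulmx1 /x /y subrK [v *m u + _]addrC subrK.
have UX := polar_classM GU (trig _ _ _ _ _ Sv Gx (GLover1 m)) Ud
  (polar_class_block v xa (polar_class1 m)).
have YU := polar_classM (trig _ _ _ _ _ (S0 _ _) (GLover1 n) Gy) GU
  (polar_class_block 0 (polar_class1 n) yb) Ud.
have GYU := GLoverM (trig _ _ _ _ _ (S0 _ _) (GLover1 n) Gy) GU.
have WYU := polar_classM (trig _ _ _ _ _ Sv (GLover1 n) (GLover1 m)) GYU
  (polar_class_block v (polar_class1 n) (polar_class1 m)) YU.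
rewrite -/X -/W -/Y UXWYU in UX WYU; have ab := polar_class_uniq UX WYU.
case: yb => w yw bw; exists w => //.
have -> : a - w = d + (a + 0) - (0 + 0 + (0 + b + d)) + (b - w) by ring.
exact: rpredD.
Qed.

Lemma neutral_transvection n (i j : 'I_n) a :
  i != j -> neutral V (1%:M + a *: delta_mx i j).
Proof.
move=> ij; have e0 p q : p <> i \/ q <> j ->
    (1%:M + a *: delta_mx i j) p q = (p == q)%:R :> F.
  rewrite !mxE => pq; suff -> : (p == i) && (q == j) = false by rewrite mulr0 addr0.
  by apply/negP => /andP[/eqP pi /eqP qj]; case: pq.
have diag p : (1%:M + a *: delta_mx i j) p p = 1 :> F.
  rewrite e0 ?eqxx //; have [->|/eqP] := eqVneq p i; [right; exact/eqP | by left].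
apply: (neutral_unipotent _ (w := fun l => (l == i) : nat)); last first.
  move=> p q pq; apply: e0.
  have [pi|/eqP] := eqVneq p i; [right => qj | by left].
  by move: pq; rewrite qj pi eqxx eq_sym (negPf ij).
have [lt_ij|lt_ji|/val_inj e] := ltngtP i j; last by rewrite e eqxx in ij.
  rewrite -det_tr det_trig ?big1 // => [l _|]; first by rewrite mxE diag.
  apply/is_trig_mxP => p q pq; rewrite mxE e0; first by rewrite -val_eqE gtn_eqF.
  have [qi|/eqP] := eqVneq q i; [right => pj | by left].
  by move: pq; rewrite pj qi ltnNge ltnW.
rewrite det_trig ?big1 //.
apply/is_trig_mxP => p q pq; rewrite e0; first by rewrite -val_eqE ltn_eqF.
have [pi|/eqP] := eqVneq p i; [right => qj | by left].
by move: pq; rewrite qj pi ltnNge ltnW.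
Qed.

(** Elementary matrices over a ring that maps to S: the cochain is 0 on
    transvections, and it is a homomorphism modulo T. *)
Lemma polar_class_El (A : pzRingType) (f : {rmorphism A -> F}) n (e : 'M_n) :
  (forall x, f x \in S) -> El_mx e ->
  GLover (map_mx f e) /\ polar_class (map_mx f e) 0.
Proof.
move=> Sf; elim=> [|i j a e' ij _ [Ge' ce']].
  by rewrite map_mx1; split; [exact: GLover1 | exact: polar_class1].
rewrite map_mxM map_mxD map_mx1 map_mxZ map_delta_mx; set x := 1%:M + _.
have Sd b : f b *: delta_mx i j \is a @mxOver n n F S.
  by apply/mxOverP => p q; rewrite !mxE; case: andP => _; rewrite ?mulr0 ?mulr1 ?rpred0.
have Gx : GLover x.
  apply: (@GLover_intro _ _ (1%:M - f a *: delta_mx i j)).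
  - rewrite mulmxBr mulmx1 mulmxDl mul1mx -scalemxAl -scalemxAr mul_delta_mx_0 ?scaler0.
      by rewrite addr0 addrK.
    by rewrite eq_sym.
  - by rewrite rpredD ?mxOver1.
  - by rewrite rpredB ?mxOver1.
split; first exact: GLoverM.
rewrite -[0]addr0; apply: polar_classM => //.
exact/polar_class_part/polar_part_neutral/neutral_transvection.
Qed.

End PolarClass.

(** * Nilpotent endomorphisms of projective modules *)

Lemma linear_mulmx (A : comNzRingType) n m (h : {linear 'cV[A]_n -> 'cV[A]_m}) :
  exists M : 'M_(m, n), forall v, M *m v = h v.
Proof.
exists (\matrix_(i, j) h (delta_mx j 0) i 0) => v.
rewrite [in RHS](cV_sum_delta v) linear_sum /=; apply/matrixP => i j.
rewrite ord1 summxE mxE; apply: eq_bigr => l _.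
by rewrite linearZ /= !mxE mulrC.
Qed.

Lemma mulmx_inj (A : comNzRingType) n m (M N : 'M[A]_(m, n)) :
  (forall v : 'cV_n, M *m v = N *m v) -> M = N.
Proof.
move=> MN; apply/matrixP => i j; have /colP/(_ i) := MN (delta_mx j 0).
by rewrite -!colE !mxE.
Qed.

Section NilPolar.

Variables (F : fieldType) (V : biderField F) (S : subringClosed F) (T : zmodClosed F).
Hypothesis mulST : forall x y, x \in S -> y \in T -> x * y \in T.
Hypothesis dAdB_T : forall x y, x \in S -> y \in S -> dA V x * dB V y \in T.
Variables (A : comNzRingType) (f : {rmorphism A -> F}).
Hypothesis fS : forall x, f x \in S.

Local Notation pmod := (polar_mod V T).

(** [W] is the matrix of the endomorphism after the embedding of the module as a
    retract of a free module. *)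
Definition nil_matrix (X : nilMod A) n (W : 'M[A]_n) :=
  exists (i : {linear proj_mod (nil_mod X) -> 'cV[A]_n})
         (p : {linear 'cV[A]_n -> proj_mod (nil_mod X)}),
    (forall x, p (i x) = x) /\ (forall v, W *m v = i (nil_end X (p v))).

Lemma projective_retract (P : projMod A) : exists n
    (i : {linear proj_mod P -> 'cV[A]_n}) (p : {linear 'cV[A]_n -> proj_mod P}),
  forall x, p (i x) = x.
Proof.
case: P => P /= [n [g gP]] projP.
pose p (v : 'cV[A]_n) := \sum_i v i 0 *: g i.
have p_lin : linear p.
  move=> a u v; rewrite /p scaler_sumr -big_split; apply: eq_bigr => i _ /=.
  by rewrite !mxE scalerDl scalerA.
pose pm := GRing.isLinear.Build A 'cV[A]_n P *:%R p p_lin.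
pose pL : {linear 'cV[A]_n -> P} := HB.pack p pm.
have [|i ip] := projP _ _ pL (idfun : {linear P -> P}); last by exists n, i, pL.
move=> x; have [a ->] := gP x; exists (\col_i a i).
by rewrite /= /p; apply: eq_bigr => i _; rewrite mxE.
Qed.

Lemma nil_matrix_exists (X : nilMod A) : exists n (W : 'M[A]_n), nil_matrix X W.
Proof.
have [n [i [p ip]]] := projective_retract (nil_mod X).
have [W WP] := linear_mulmx (i \o nil_end X \o p).
by exists n, W, i, p.
Qed.

Lemma nilpotent_unit n (W : 'M[A]_n) k : W ^+ k = 0 -> exists Y, (1%:M - W) *m Y = 1%:M.
Proof.
move=> Wk; exists (\sum_(j < k) W ^+ j).
suff -> : (1%:M - W) *m (\sum_(j < k) W ^+ j) = - ((W - 1) * \sum_(j < k) W ^+ j).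
  by rewrite -subrX1 Wk sub0r opprK.
by rewrite -mulNr opprB.
Qed.

Lemma nil_matrix_nilp X n (W : 'M[A]_n) : nil_matrix X W -> exists k, W ^+ k = 0.
Proof.
case=> i [p [ip WP]]; have [k kP] := nil_nilp X; exists k.+1.
apply: mulmx_inj => v; rewrite mul0mx.
have -> m : (W ^+ m.+1) *m v = i (iter m.+1 (nil_end X) (p v)).
  elim: m => [|m IHm]; first by rewrite expr1 WP.
  by rewrite exprS -mulmxA IHm WP ip.
by rewrite iterS kP !linear0.
Qed.

Lemma nilp_GLover n (W : 'M[A]_n) k : W ^+ k = 0 -> GLover S (map_mx f (1%:M - W)).
Proof.
move=> /nilpotent_unit[Y WY].
apply: (@GLover_intro _ _ _ _ (map_mx f Y)); first by rewrite -map_mxM WY map_mx1.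
  by apply/mxOverP => i j; rewrite mxE.
by apply/mxOverP => i j; rewrite mxE.
Qed.

Definition nil_polar (X : nilMod A) (v : F) := exists n (W : 'M[A]_n),
  nil_matrix X W /\ polar_class V T (map_mx f (1%:M - W)) v.

Lemma nil_polar_exists X : exists v, nil_polar X v.
Proof.
have [n [W XW]] := nil_matrix_exists X; have [k Wk] := nil_matrix_nilp XW.
have /and3P[UW _ _] := nilp_GLover Wk.
by have [v /polar_class_part Wv] := polar_part_exists V UW; exists v, n, W.
Qed.

(** For retracts i, p and i', p' and the endomorphism f, the matrices are u v
    and v u with u = i f p' and v = i' p. *)
Lemma nil_polar_uniq X v w : nil_polar X v -> nil_polar X w -> v - w \in pmod.
Proof.
move=> [n [W [XW Wv]]] [m [W' [XW' Ww]]].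
have [k Wk] := nil_matrix_nilp XW; have G := nilp_GLover Wk.
case: XW => i [p [ip WP]]; case: XW' => i' [p' [ip' WP']].
have [u uP] := linear_mulmx (i \o nil_end X \o p').
have [s sP] := linear_mulmx (i' \o p).
have uW : u *m s = W.
  by apply: mulmx_inj => x; rewrite -mulmxA sP uP /= ip' WP.
have sW : s *m u = W'.
  by apply: mulmx_inj => x; rewrite -mulmxA uP sP /= ip WP'.
move: G Wv; rewrite -uW map_mxB map_mx1 map_mxM => G Wv.
have fo q r (M : 'M[A]_(q, r)) : map_mx f M \is a mxOver S.
  by apply/mxOverP => a b; rewrite mxE.
have := polar_class_swap mulST dAdB_T (fo _ _ u) (fo _ _ s) G Wv.
rewrite -map_mxM sW -(map_mx1 f) -map_mxB => Wv'.
exact: polar_class_uniq Wv' Ww.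
Qed.

Lemma nil_polar_zero (P : projMod A) : nil_polar (nil_of_proj P) 0.
Proof.
have [n [i [p ip]]] := projective_retract P.
exists n, 0; split.
  by exists i, p; split=> // v; rewrite mul0mx /= linear0.
by rewrite subr0 map_mx1; apply: polar_class1.
Qed.

(** A section s of the quotient map and the resulting retraction r onto the
    submodule make Y a retract of the sum of the free modules for Z and X; the
    matrix of the endomorphism is then block triangular. *)
Lemma nil_polar_ses (X Y Z : obj (Nil A)) v w :
  ses X Y Z -> nil_polar X v -> nil_polar Z w -> nil_polar Y (v + w).
Proof.
move=> [g [h [gX hY [g_inj h_surj gh]]]] [n [W [XW Wv]]] [m [W' [ZW Ww]]].
case: XW => i [p [ip WP]]; case: ZW => i' [p' [ip' WP']].
have projZ : projective (proj_mod (nil_mod Z)) by exact: proj_proj.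
have [s sP] := projZ _ _ h idfun h_surj.
have ex y : exists x, g x = y - s (h y) by apply/gh; rewrite linearB sP subrr.
have [r rP] := choice ex.
have r_lin : linear r.
  move=> a y y'; apply: g_inj; rewrite linearP !rP linearP linearP.
  by rewrite scalerBr opprD addrACA.
pose rm := GRing.isLinear.Build A _ _ *:%R r r_lin.
pose rL : {linear proj_mod (nil_mod Y) -> proj_mod (nil_mod X)} := HB.pack r rm.
have rE y : g (rL y) = y - s (h y) by exact: rP.
have rg x : rL (g x) = x.
  apply: g_inj; rewrite rE; have -> : h (g x) = 0 by apply/gh; exists x.
  by rewrite linear0 subr0.
pose iY y : 'cV[A]_(m + n) := col_mx (i' (h y)) (i (rL y)).
have iY_lin : linear iY.
  by move=> a y y'; rewrite /iY !linearP scale_col_mx add_col_mx.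
pose iYm := GRing.isLinear.Build A _ _ *:%R iY iY_lin.
pose iYL : {linear proj_mod (nil_mod Y) -> 'cV[A]_(m + n)} := HB.pack iY iYm.
pose pY (u : 'cV[A]_(m + n)) := s (p' (usubmx u)) + g (p (dsubmx u)).
have pY_lin : linear pY.
  by move=> a y y'; rewrite /pY !linearP scalerDr addrACA.
pose pYm := GRing.isLinear.Build A _ _ *:%R pY pY_lin.
pose pYL : {linear 'cV[A]_(m + n) -> proj_mod (nil_mod Y)} := HB.pack pY pYm.
have [M MP] := linear_mulmx (i \o rL \o nil_end Y \o s \o p').
exists (m + n)%N, (block_mx W' 0 M W); split; last first.
  rewrite scalar_mx_block opp_block_mx add_block_mx oppr0 !addr0 add0r map_block_mx.
  rewrite map_mx0 [v + w]addrC; exact: polar_class_block.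
exists iYL, pYL; split=> [y|u].
  by rewrite /= /pY /iY col_mxKu col_mxKd ip ip' rE subrKC.
have hg x : h (g x) = 0 by apply/gh; exists x.
rewrite -{1}[u]vsubmxK mul_block_col mul0mx addr0 /= /iY /pY.
set a := p' _; set b := p _.
have -> : nil_end Y (s a + g b) = nil_end Y (s a) + g (nil_end X b).
  by rewrite linearD gX.
rewrite [h _]linearD hY sP hg addr0 [rL _]linearD rg [i _]linearD WP' MP WP.
by [].
Qed.

(** An arbitrary representative is chosen for each module, as values matter only
    modulo [pmod]. *)
Fixpoint nil_eval (x : K0 (Nil A)) : F :=
  match x with
  | K0_class X => sval (cid (nil_polar_exists X))
  | K0_zero => 0
  | K0_opp x => - nil_eval x
  | K0_add x y => nil_eval x + nil_eval y
  end.

Lemma nil_eval_K0_eq x y : K0_eq x y -> nil_eval x - nil_eval y \in pmod.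
Proof.
elim=> {x y} /=.
- by move=> x; rewrite subrr rpred0.
- by move=> x y _; rewrite -rpredN opprB.
- by move=> x y w _ xy _ yw; rewrite -(subrKA (nil_eval y)) rpredD.
- by move=> x x' _ xx'; rewrite -opprD rpredN.
- by move=> x x' y y' _ xx' _ yy'; rewrite opprD addrACA rpredD.
- by move=> x y w; rewrite addrA subrr rpred0.
- by move=> x y; rewrite [X in X - _]addrC subrr rpred0.
- by move=> x; rewrite add0r subrr rpred0.
- by move=> x; rewrite addNr subrr rpred0.
move=> X Y Z XYZ; case: cid => /= y Yy; case: cid => /= x Xx; case: cid => /= w Zw.
exact: nil_polar_uniq Yy (nil_polar_ses XYZ Xx Zw).
Qed.

Lemma nil_eval_zero_end (u : K0 (Proj A)) :
  nil_eval (@K0_map (Proj A) (Nil A) (@nil_of_proj A) u) \in pmod.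
Proof.
elim: u => [P||x IHx|x IHx y IHy] /=; last 1 first.
- exact: rpredD.
- case: cid => /= v Pv; rewrite -[v]subr0.
  exact: nil_polar_uniq Pv (nil_polar_zero P).
- exact: rpred0.
- by rewrite rpredN.
Qed.

Lemma Nil0_eq0_polar n (N : 'M[A]_n) (hN : mx_nilpotent N) v :
  polar_class V T (map_mx f (1%:M - N)) v ->
  Nil0_eq (Nil0_class hN) K0_zero -> v \in pmod.
Proof.
move=> Nv [u /nil_eval_K0_eq]; rewrite /= addr0; case: cid => /= w Nw wu.
have Nv' : nil_polar (nil_of_mx hN) v by exists n, N; split=> //; exists idfun, idfun.
have -> : v = (v - w) + (w - nil_eval (@K0_map (Proj A) (Nil A) (@nil_of_proj A) u))
    + nil_eval (@K0_map (Proj A) (Nil A) (@nil_of_proj A) u) by ring.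
apply: rpredD; last exact: nil_eval_zero_end.
by apply: rpredD => //; exact: nil_polar_uniq Nv' Nw.
Qed.

End NilPolar.

(** * Derivations of a field of fractions *)

Section QuotientRule.

Variables (F : fieldType) (x y z w dx dy dz dw : F).
Hypotheses (y0 : y != 0) (w0 : w != 0).

Lemma quotient_sub : x / y - z / w = (x * w - z * y) / (y * w).
Proof. by field; rewrite y0 w0. Qed.

Lemma quotient_mul : x / y * (z / w) = (x * z) / (y * w).
Proof. by field; rewrite y0 w0. Qed.

Lemma quotient_rule_sub :
  (((dx * w + x * dw) - (dz * y + z * dy)) * (y * w)
     - (x * w - z * y) * (dy * w + y * dw)) / (y * w) ^+ 2 =
  (dx * y - x * dy) / y ^+ 2 - (dz * w - z * dw) / w ^+ 2.
Proof. by field; rewrite y0 w0. Qed.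

Lemma quotient_rule_mul :
  ((dx * z + x * dz) * (y * w) - (x * z) * (dy * w + y * dw)) / (y * w) ^+ 2 =
  (dx * y - x * dy) / y ^+ 2 * (z / w) + x / y * ((dz * w - z * dw) / w ^+ 2).
Proof. by field; rewrite y0 w0. Qed.

End QuotientRule.

Section FracDerivation.

Variables (D : idomainType) (d : {additive D -> D}).
Hypothesis dM : forall x y, d (x * y) = d x * y + x * d y.

Local Notation "x %:F" := (@tofrac D x).

Lemma frac_exists (x : {fraction D}) :
  exists a : D * D, a.2 != 0 /\ x = a.1%:F / a.2%:F.
Proof.
elim/quotW: x => r; exists (\n_r, \d_r); split; first exact: denom_ratioP.
unlock tofrac; rewrite -[X in _ = _ * X]FracField.pi_inv -[RHS]FracField.pi_mul.
rewrite /FracField.mulf /FracField.invf /= !numden_Ratio ?oner_neq0 ?denom_ratioP //.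
by rewrite mulr1 mul1r Ratio_numden.
Qed.

Definition frac_der (x : {fraction D}) : {fraction D} :=
  let a := sval (cid (frac_exists x)) in
  (d a.1 * a.2 - a.1 * d a.2)%:F / (a.2 ^+ 2)%:F.

Lemma frac_derE a b : b != 0 ->
  frac_der (a%:F / b%:F) = (d a * b - a * d b)%:F / (b ^+ 2)%:F.
Proof.
move=> b0; rewrite /frac_der; case: cid => -[a' b'] /= [b'0 /eqP].
rewrite eqr_div ?tofrac_eq0 // -!tofracM tofrac_eq => /eqP e.
have /(congr1 ( *%R (b * b'))) : d (a * b') = d (a' * b) by rewrite e.
rewrite !dM !mulrDr => de.
apply/eqP; rewrite eqr_div ?tofrac_eq0 ?expf_neq0 // -!tofracM tofrac_eq; apply/eqP.
have -> : (d a' * b' - a' * d b') * b ^+ 2 =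
   b * b' * (d a' * b) + b * b' * (a' * d b) - b * b' * (a' * d b) - (a' * b) * b * d b'.
  by ring.
rewrite -de -e; ring: e.
Qed.

Lemma frac_der_tofrac a : frac_der a%:F = (d a)%:F.
Proof.
have := frac_derE a (oner_neq0 D); rewrite tofrac1 divr1 => ->.
have d1 : d 1 = 0.
  by have /eqP := dM 1 1; rewrite !mul1r mulr1 -subr_eq0 opprD addNKr oppr_eq0
    => /eqP.
by rewrite d1 mulr0 subr0 mulr1 expr1n tofrac1 divr1.
Qed.

Lemma frac_der_zmod : zmod_morphism frac_der.
Proof.
move=> x y; have [[a b] /= [b0 ->]] := frac_exists x.
have [[a' b'] /= [b'0 ->]] := frac_exists y.
have [b0F b'0F] : b%:F != 0 /\ b'%:F != 0 by rewrite !tofrac_eq0.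
rewrite quotient_sub // -!tofracM -tofracB !frac_derE ?mulf_neq0 //.
have -> : d (a * b' - a' * b) = d a * b' + a * d b' - (d a' * b + a' * d b).
  by rewrite raddfB /= !dM.
by rewrite dM !tofracXn !(tofracB, tofracM, tofracD) quotient_rule_sub.
Qed.

Lemma frac_derM x y : frac_der (x * y) = frac_der x * y + x * frac_der y.
Proof.
have [[a b] /= [b0 ->]] := frac_exists x.
have [[a' b'] /= [b'0 ->]] := frac_exists y.
have [b0F b'0F] : b%:F != 0 /\ b'%:F != 0 by rewrite !tofrac_eq0.
rewrite quotient_mul // -!tofracM !frac_derE ?mulf_neq0 // !dM.
by rewrite !tofracXn !(tofracB, tofracM, tofracD) quotient_rule_mul.
Qed.

End FracDerivation.

(** * Cuspidal elements and the degree valuation *)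

Section Localization.

Variables (F : fieldType) (V : biderField F) (L : subringClosed F).
Local Notation t := (vpar V).
Hypothesis LD : forall x, x \in L -> dA V x \in L.

Definition vpar_ideal : {pred F} := fun x => x / t \in L.

Lemma vpar_idealE x : (x \in vpar_ideal) = (x / t \in L). Proof. by []. Qed.

Lemma vpar_ideal_zmod : zmod_closed vpar_ideal.
Proof.
split=> [|x y]; rewrite !vpar_idealE ?mul0r ?rpred0 // mulrBl.
exact: rpredB.
Qed.

HB.instance Definition _ := GRing.isZmodClosed.Build F vpar_ideal vpar_ideal_zmod.

(** With L = Q[t, z, z^-1] these are the Laurent polynomials without a term
    linear in t: exactly the cuspidal ring Q[t^2, t^3, z, z^-1]. *)
Definition cuspidal : {pred F} := fun x => (x \in L) && (dB V x \in vpar_ideal).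

Lemma vpar_idealM x y : x \in L -> y \in vpar_ideal -> x * y \in vpar_ideal.
Proof. by rewrite !vpar_idealE -mulrA => Lx Ly; apply: rpredM. Qed.

Lemma cuspidal_subring : subring_closed cuspidal.
Proof.
split.
- by rewrite unfold_in rpred1 (leibniz1 (@dB_mul F V)) rpred0.
- move=> x y /andP[Lx Ex] /andP[Ly Ey].
  by rewrite unfold_in rpredB // raddfB; apply: rpredB.
move=> x y /andP[Lx Ex] /andP[Ly Ey]; rewrite unfold_in rpredM //= dB_mul.
by apply: rpredD; [rewrite mulrC|]; apply: vpar_idealM.
Qed.

HB.instance Definition _ :=
  GRing.isSubringClosed.Build F cuspidal cuspidal_subring.

Lemma cuspidal_mul_ideal x y : x \in cuspidal -> y \in vpar_ideal -> x * y \in vpar_ideal.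
Proof. by case/andP=> Lx _; apply: vpar_idealM. Qed.

Lemma cuspidal_dAdB x y :
  x \in cuspidal -> y \in cuspidal -> dA V x * dB V y \in vpar_ideal.
Proof. by move=> /andP[Lx _] /andP[_ Ey]; apply: vpar_idealM => //; apply: LD. Qed.

End Localization.

(** The model is Q[t][z] with [dvar] = t and [dunit] = z, which is inverted
    later.  As for polynomials, [dsize] is the degree in t plus 1, and 0 at 0;
    [derA] is d/dz and [derB] is d/dt. *)
Record degreeData (D : idomainType) := DegreeData {
  dsize : D -> nat;
  dvar : D;
  dunit : D;
  derA : {additive D -> D};
  derB : {additive D -> D};
  dsize_gt0 : forall p, (0 < dsize p)%N = (p != 0);
  dsizeM : forall p q, p != 0 -> q != 0 -> (dsize (p * q)).+1 = (dsize p + dsize q)%N;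
  dsizeB : forall p q m, (dsize p <= m -> dsize q <= m -> dsize (p - q) <= m)%N;
  dsize_var : dsize dvar = 2;
  dsize_unit : dsize dunit = 1;
  dunit_var : forall k p, dunit ^+ k != dvar * p;
  derAM : forall p q, derA (p * q) = derA p * q + p * derA q;
  derBM : forall p q, derB (p * q) = derB p * q + p * derB q;
  derA_var : derA dvar = 0;
  dsize_derA : forall p, (dsize (derA p) <= dsize p)%N;
  dsize_derB : forall p, p != 0 -> (dsize (derB p) < dsize p)%N }.

Section DegreeValuation.

Variables (D : idomainType) (P : degreeData D).

Local Notation sz := (dsize P).
Local Notation T := (dvar P).
Local Notation Z := (dunit P).
Local Notation d1 := (derA P).
Local Notation d2 := (derB P).
Let sz_gt0 := dsize_gt0 P.
Let szM := @dsizeM _ P.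
Let szB := @dsizeB _ P.
Let szT := dsize_var P.
Let szZ := dsize_unit P.
Let ZT := dunit_var P.
Let d1M := derAM P.
Let d2M := derBM P.
Let d1T := derA_var P.
Let sz_d1 := dsize_derA P.
Let sz_d2 := @dsize_derB _ P.

Local Notation "x %:F" := (@tofrac D x).

Lemma sz0 : sz 0 = 0%N.
Proof. by apply/eqP; rewrite -leqn0 leqNgt sz_gt0 eqxx. Qed.

Lemma sz_leM p q r s : r != 0 -> s != 0 ->
  (sz p <= sz r)%N -> (sz q <= sz s)%N -> (sz (p * q) <= sz (r * s))%N.
Proof.
move=> r0 s0 pr qs.
have [->|p0] := eqVneq p 0; first by rewrite mul0r sz0.
have [->|q0] := eqVneq q 0; first by rewrite mulr0 sz0.
by rewrite -ltnS !szM // leq_add.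
Qed.

Lemma T_neq0 : T != 0. Proof. by rewrite -sz_gt0 szT. Qed.

Lemma sz_TX m p : p != 0 -> sz (p * T ^+ m) = (sz p + m)%N.
Proof.
move=> p0; elim: m => [|m IHm]; first by rewrite mulr1 addn0.
apply: succn_inj; rewrite exprSr mulrA szM ?T_neq0 ?mulf_neq0 ?expf_neq0 ?T_neq0 //.
by rewrite IHm szT !addnS addn0.
Qed.

Definition bounded : {pred {fraction D}} := fun x =>
  `[< exists p : D * D,
        [/\ p.2 != 0, x = p.1%:F / p.2%:F & (sz p.1 <= sz p.2)%N] >].

Lemma bounded_intro p q : q != 0 -> (sz p <= sz q)%N -> p%:F / q%:F \in bounded.
Proof. by move=> q0 pq; apply/asboolP; exists (p, q). Qed.

Lemma bounded_subring : subring_closed bounded.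
Proof.
split.
- by rewrite -[1](divff (oner_neq0 _)) -tofrac1 bounded_intro ?oner_neq0.
- move=> _ _ /asboolP[[p q] /= [q0 -> pq]] /asboolP[[r s] /= [s0 -> rs]].
  have [q0F s0F] : q%:F != 0 /\ s%:F != 0 by rewrite !tofrac_eq0.
  rewrite quotient_sub // -!tofracM -tofracB bounded_intro ?mulf_neq0 //.
  by apply: szB; [apply: sz_leM | rewrite mulrC; apply: sz_leM].
- move=> _ _ /asboolP[[p q] /= [q0 -> pq]] /asboolP[[r s] /= [s0 -> rs]].
  have [q0F s0F] : q%:F != 0 /\ s%:F != 0 by rewrite !tofrac_eq0.
  by rewrite quotient_mul // -!tofracM bounded_intro ?mulf_neq0 // sz_leM.
Qed.

HB.instance Definition _ :=
  GRing.isSubringClosed.Build {fraction D} bounded bounded_subring.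

Lemma TV_bounded : T%:F^-1 \in bounded.
Proof.
rewrite -div1r -tofrac1 bounded_intro ?T_neq0 //.
by rewrite -[T in leqRHS]expr1 -[T ^+ 1]mul1r sz_TX ?oner_neq0 // addn1.
Qed.

Lemma fraction_bounded p q : q != 0 -> p%:F / q%:F \in bounded -> (sz p <= sz q)%N.
Proof.
move=> q0 /asboolP[[r s] /= [s0 /eqP e rs]].
have [->|p0] := eqVneq p 0; first by rewrite sz0.
move: e; rewrite eqr_div ?tofrac_eq0 // -!tofracM tofrac_eq => /eqP e.
have r0 : r != 0 by apply: contra_eq_neq e => ->; rewrite mul0r mulf_neq0.
by rewrite -(leq_add2r (sz s)) -szM // e szM // addnC leq_add2l.
Qed.

Lemma T_bounded : T%:F \notin bounded.
Proof.
rewrite -[T%:F]divr1 -tofrac1; apply/negP => /(fraction_bounded (oner_neq0 _)).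
by rewrite -[T]expr1 -[T ^+ 1]mul1r sz_TX ?oner_neq0 // addn1 ltnn.
Qed.

Lemma bounded_val x : x != 0 -> exists a b : nat,
  let u := x * T%:F ^+ a / T%:F ^+ b in (u \in bounded) && (u^-1 \in bounded).
Proof.
have [[p q] /= [q0 ->]] := frac_exists x => pq0.
have p0 : p != 0 by apply: contra_neq pq0 => ->; rewrite tofrac0 mul0r.
exists (sz q), (sz p).
have e : p%:F / q%:F * T%:F ^+ sz q / T%:F ^+ sz p =
   (p * T ^+ sz q)%:F / (q * T ^+ sz p)%:F.
  by rewrite !tofracM !tofracXn invfM mulrACA mulrA mulrAC -!mulrA.
rewrite e invf_div; apply/andP; split; apply: bounded_intro;
  by rewrite ?mulf_neq0 ?expf_neq0 ?T_neq0 // !sz_TX // addnC.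
Qed.

Lemma frac_der_log (d : {additive D -> D}) p q : p != 0 -> q != 0 ->
  (forall x y, d (x * y) = d x * y + x * d y) ->
  frac_der d (p%:F / q%:F) / (p%:F / q%:F) = (d p * q - d q * p)%:F / (p * q)%:F.
Proof.
move=> p0 q0 dM; rewrite frac_derE // tofracXn [p * d q]mulrC.
have [p0F q0F] : p%:F != 0 /\ q%:F != 0 by rewrite !tofrac_eq0.
move: (_%:F) => r; rewrite tofracM.
by rewrite invf_div mulrA expr2 invfM mulrA mulfVK // -mulrA -invfM [q%:F * _]mulrC.
Qed.

Definition frac_additive (d : {additive D -> D})
    (dM : forall x y, d (x * y) = d x * y + x * d y) : {additive {fraction D} -> {fraction D}} :=
  HB.pack (frac_der d)
    (GRing.isZmodMorphism.Build {fraction D} {fraction D} (frac_der d) (frac_der_zmod dM)).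

Lemma frac_der_log_bounded x : frac_der d1 x / x \in bounded.
Proof.
have [[p q] /= [q0 ->]] := frac_exists x.
have [->|p0] := eqVneq p 0; first by rewrite tofrac0 mul0r invr0 mulr0 rpred0.
rewrite frac_der_log // bounded_intro ?mulf_neq0 //.
apply: szB; first by rewrite sz_leM.
by rewrite mulrC [p * q]mulrC [q * p]mulrC; apply: sz_leM.
Qed.

Lemma frac_der_log_vanish x : T%:F * (frac_der d2 x / x) \in bounded.
Proof.
have [[p q] /= [q0 ->]] := frac_exists x.
have [->|p0] := eqVneq p 0; first by rewrite tofrac0 mul0r invr0 !mulr0 rpred0.
rewrite frac_der_log // mulrA -tofracM bounded_intro ?mulf_neq0 //.
have d2_lt u : u != 0 -> (sz (T * d2 u) <= sz u)%N.
  move=> u0; have [->|du0] := eqVneq (d2 u) 0; first by rewrite mulr0 sz0.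
  by rewrite -ltnS szM ?T_neq0 // szT !addSn add0n !ltnS sz_d2.
rewrite mulrBr !mulrA; apply: szB; first by apply: sz_leM => //; apply: d2_lt.
by rewrite [p * q]mulrC; apply: sz_leM => //; apply: d2_lt.
Qed.

Lemma frac_der_T : frac_der d1 T%:F = 0.
Proof. by rewrite frac_der_tofrac // d1T tofrac0. Qed.

Definition degree_biderField : biderField {fraction D} :=
  @BiderField {fraction D} bounded T%:F (frac_additive d1M) (frac_additive d2M)
    (frac_derM d1M) (frac_derM d2M) frac_der_T TV_bounded T_bounded bounded_val
    frac_der_log_bounded frac_der_log_vanish.

Lemma Z_neq0 : Z != 0. Proof. by rewrite -sz_gt0 szZ. Qed.

Lemma ZX_neq0 k : Z ^+ k != 0. Proof. by rewrite expf_neq0 ?Z_neq0. Qed.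

Lemma sz1 : sz 1 = 1.
Proof. by have := szM (oner_neq0 D) (oner_neq0 D); rewrite mulr1 -add1n => /addIn. Qed.

Lemma sz_ZX k : sz (Z ^+ k) = 1.
Proof.
elim: k => [|k IHk]; first exact: sz1.
by apply: succn_inj; rewrite exprS szM ?Z_neq0 ?ZX_neq0 // IHk szZ.
Qed.

Definition localized : {pred {fraction D}} := fun x =>
  `[< exists p : D * nat, x = p.1%:F / (Z ^+ p.2)%:F >].

Lemma localized_intro p k : p%:F / (Z ^+ k)%:F \in localized.
Proof. by apply/asboolP; exists (p, k). Qed.

Lemma localized_tofrac p : p%:F \in localized.
Proof. by rewrite -[p%:F]divr1 -tofrac1; apply: (localized_intro p 0). Qed.

Lemma localized_subring : subring_closed localized.
Proof.
split.
- by rewrite -tofrac1 localized_tofrac.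
- move=> _ _ /asboolP[[p k] /= ->] /asboolP[[r l] /= ->].
  rewrite quotient_sub ?tofrac_eq0 ?ZX_neq0 // -!tofracM -tofracB -exprD.
  exact: localized_intro.
move=> _ _ /asboolP[[p k] /= ->] /asboolP[[r l] /= ->].
rewrite quotient_mul ?tofrac_eq0 ?ZX_neq0 // -!tofracM -exprD.
exact: localized_intro.
Qed.

HB.instance Definition _ :=
  GRing.isSubringClosed.Build {fraction D} localized localized_subring.

Local Notation V := degree_biderField.

Lemma dA_degreeE x : dA V x = frac_der d1 x. Proof. by []. Qed.

Lemma dB_degreeE x : dB V x = frac_der d2 x. Proof. by []. Qed.

Lemma vpar_degreeE : vpar V = T%:F. Proof. by []. Qed.

Lemma localized_dA x : x \in localized -> dA V x \in localized.
Proof.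
case/asboolP=> -[p k] ->.
by rewrite dA_degreeE frac_derE ?ZX_neq0 // -exprM; apply: localized_intro.
Qed.

Lemma cuspidal_tofrac p r : d2 p = T * r -> p%:F \in cuspidal V localized.
Proof.
move=> d2p; rewrite unfold_in localized_tofrac vpar_idealE.
rewrite dB_degreeE frac_der_tofrac // d2p tofracM.
rewrite vpar_degreeE mulrAC mulfV ?tofrac_eq0 ?T_neq0 // mul1r.
exact: localized_tofrac.
Qed.

Lemma cuspidal_ZV : d2 Z = 0 -> (Z%:F)^-1 \in cuspidal V localized.
Proof.
move=> d2Z; have Z0 : Z%:F != 0 by rewrite tofrac_eq0 Z_neq0.
rewrite unfold_in -{1}[Z]expr1 -[X in X \in localized]div1r -tofrac1 localized_intro.
suff -> : dB V (Z%:F)^-1 = 0 by exact: rpred0.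
apply: (mulfI Z0); rewrite mulr0; have := dB_mul V Z%:F (Z%:F)^-1.
rewrite mulfV // (leibniz1 (@dB_mul _ V)) dB_degreeE.
by rewrite frac_der_tofrac // d2Z tofrac0 mul0r add0r.
Qed.

(** A Laurent polynomial that vanishes at infinity is 0: this is the only place
    where it matters that L consists of polynomials in t, and not of power
    series. *)
Lemma localized_vmax x : x \in localized -> x \in vmax V -> x = 0.
Proof.
case/asboolP=> -[p k] ->; rewrite [_.1]/= [_.2]/= vmaxE vpar_degreeE mulrA -tofracM.
move=> /(fraction_bounded (ZX_neq0 k)); rewrite sz_ZX.
have [->|p0] := eqVneq p 0; first by rewrite tofrac0 mul0r.
by rewrite mulrC -[T]expr1 sz_TX // addn1 ltnS leqn0 => /eqP sp; move: p0; rewrite -sz_gt0 sp.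
Qed.

(** An element of t L that agrees with the symbol modulo [vmax] is equal to it
    by [localized_vmax], and then t would divide a power of z. *)
Lemma cusp_symbol_neq0 :
  (1 + T%:F + T%:F ^+ 2 - T%:F ^+ 3) / Z%:F \notin polar_mod V (vpar_ideal V localized).
Proof.
apply/negP => /asboolP[q]; rewrite vpar_idealE vpar_degreeE => Lq.
set v := _ / _ => vq.
have Lv : v \in localized.
  rewrite /v -[Z]expr1 -!tofracXn -tofrac1 -!tofracD -tofracB.
  exact: localized_intro.
have T0 : T%:F != 0 by rewrite tofrac_eq0 T_neq0.
have {}vq : v = q.
  apply/eqP; rewrite -subr_eq0; apply/eqP/localized_vmax => //.
  by rewrite rpredB // -[q](divfK T0) rpredM // localized_tofrac.
move: Lq; rewrite -vq => /asboolP[[p k] /= /eqP].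
rewrite /v -mulrA -invfM -!tofracXn -tofracM -tofrac1 -!tofracD -tofracB.
rewrite eqr_div ?tofrac_eq0 ?mulf_neq0 ?Z_neq0 ?T_neq0 ?ZX_neq0 //.
rewrite -!tofracM tofrac_eq => /eqP e.
case/eqP: (ZT k (p * Z - (1 + T - T ^+ 2) * Z ^+ k)).
by rewrite mulrBr [T * (p * Z)]mulrC -mulrA -e; ring.
Qed.

End DegreeValuation.

(** * The invariant of the commutator *)

Lemma mx_of_rows2M (R : pzRingType) (a b c d a' b' c' d' : R) :
  mx_of_rows 2 [:: [:: a; b]; [:: c; d]] *m mx_of_rows 2 [:: [:: a'; b']; [:: c'; d']] =
  mx_of_rows 2 [:: [:: a * a' + b * c'; a * b' + b * d'];
                   [:: c * a' + d * c'; c * b' + d * d']].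
Proof.
apply/matrixP => i j; rewrite !mxE !big_ord_recl big_ord0 addr0 !mxE /=.
by case: i => [[|[|]]] //; case: j => [[|[|]]].
Qed.

Lemma map_mx_of_rows2 (R S : pzRingType) (f : R -> S) (a b c d : R) :
  map_mx f (mx_of_rows 2 [:: [:: a; b]; [:: c; d]]) =
  mx_of_rows 2 [:: [:: f a; f b]; [:: f c; f d]].
Proof.
apply/matrixP => i j; rewrite !mxE.
by case: i => [[|[|]]] //; case: j => [[|[|]]].
Qed.

Lemma scalar_mx_of_rows2 (R : pzRingType) :
  1%:M = mx_of_rows 2 [:: [:: 1; 0]; [:: 0; 1]] :> 'M[R]_2.
Proof.
apply/matrixP => i j; rewrite !mxE.
by case: i => [[|[|]]] //; case: j => [[|[|]]].
Qed.

Lemma mxtrace_mx_of_rows2 (R : pzRingType) (a b c d : R) :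
  \tr (mx_of_rows 2 [:: [:: a; b]; [:: c; d]]) = a + d.
Proof. by rewrite /mxtrace !big_ord_recl big_ord0 addr0 !mxE. Qed.

Definition mx2E := (mx_of_rows2M, map_mx_of_rows2, scalar_mx_of_rows2, mxtrace_mx_of_rows2).

Section CuspSymbol.

Variables (F : fieldType) (V : biderField F) (z : F).
Local Notation t := (vpar V).
Local Notation D := (dA V).
Local Notation E := (dB V).
Hypotheses (z0 : z != 0) (zO : z \in vring V) (zVO : z^-1 \in vring V).
Hypotheses (Dz : D z = 1) (Ez : E z = 0) (Et : E t = 1).

Local Notation mx2 a b c d := (mx_of_rows 2 [:: [:: a; b]; [:: c; d]]).

Lemma neutral_upper2 a : neutral V (mx2 1 a 0 1).
Proof.
suff -> : mx2 1 a 0 1 = 1%:M + a *: delta_mx 0 1 by exact: neutral_transvection.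
apply/matrixP => i j; rewrite !mxE.
by case: i => [[|[|]]] //; case: j => [[|[|]]] //= *; rewrite ?(mulr1, mulr0, addr0, add0r).
Qed.

Lemma neutral_lower2 a : neutral V (mx2 1 0 a 1).
Proof.
suff -> : mx2 1 0 a 1 = 1%:M + a *: delta_mx 1 0 by exact: neutral_transvection.
apply/matrixP => i j; rewrite !mxE.
by case: i => [[|[|]]] //; case: j => [[|[|]]] //= *; rewrite ?(mulr1, mulr0, addr0, add0r).
Qed.

(** With d = diag(z, 1) the matrix is M d M^-1 d^-1.  All four factors have
    cochain 0.  In the sum of the cocycle values only
    c(d, M^-1 d^-1) = tr (d^-1 D(d) E(M^-1) M) is left, because D kills M and
    M^-1 and E kills d^-1. *)
Lemma cusp_symbol : polar_part V
  (mx2 (1 - (1 - z^-1) * t ^+ 4) ((z - 1) * (t ^+ 2 - t ^+ 3))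
       ((1 - z^-1) * (t ^+ 2 + t ^+ 3 + t ^+ 4 + t ^+ 5)) (1 + (z - 1) * t ^+ 4))
  ((1 + t + t ^+ 2 - t ^+ 3) / z).
Proof.
have t0 := vpar_neq0 V.
have D1 : D 1 = 0 := leibniz1 (@dA_mul F V).
have E1 : E 1 = 0 := leibniz1 (@dB_mul F V).
(* M = (1 - t, - t^2; t^2, 1 + t + t^2 + t^3) as lower * upper * lower *)
pose d := mx2 z 0 0 1; pose di := mx2 z^-1 0 0 1.
pose p := (1 + t + t ^+ 2) / t.
pose M := mx2 1 0 (- p) 1 *m (mx2 1 (- t ^+ 2) 0 1 *m mx2 1 0 t^-1 1).
pose Mi := mx2 1 0 (- t^-1) 1 *m (mx2 1 (t ^+ 2) 0 1 *m mx2 1 0 p 1).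
have ddi : d *m di = 1%:M.
  by rewrite !mx2E !(mul0r, mulr0, mul1r, add0r, addr0) mulfV.
have did := mulmx1C ddi.
have ME : M = mx2 (1 - t) (- t ^+ 2) (t ^+ 2) (1 + t + t ^+ 2 + t ^+ 3).
  by rewrite /M !mx2E /p; congr (mx2 _ _ _ _); field; rewrite ?t0 ?oner_neq0.
have MiE : Mi = mx2 (1 + t + t ^+ 2 + t ^+ 3) (t ^+ 2) (- t ^+ 2) (1 - t).
  by rewrite /Mi !mx2E /p; congr (mx2 _ _ _ _); field; rewrite ?t0 ?oner_neq0.
have MMi : M *m Mi = 1%:M.
  by rewrite ME MiE !mx2E; congr (mx2 _ _ _ _); ring.
have -> : mx2 (1 - (1 - z^-1) * t ^+ 4) ((z - 1) * (t ^+ 2 - t ^+ 3))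
       ((1 - z^-1) * (t ^+ 2 + t ^+ 3 + t ^+ 4 + t ^+ 5)) (1 + (z - 1) * t ^+ 4) =
   M *m (d *m (Mi *m di)).
  by rewrite ME MiE !mx2E; congr (mx2 _ _ _ _); field; rewrite ?z0 ?oner_neq0.
have DtX m : D (t ^+ m) = 0 := dA_vparX V m.
have DtV : D t^-1 = 0 by rewrite -[t]expr1 dA_vparXV.
have Dt : D t = 0 := dA_vpar V.
have Dp : D p = 0.
  by rewrite /p dA_mul !raddfD /= D1 Dt DtX DtV !(addr0, mul0r, mulr0).
have DM x y : map_mx D x = 0 -> map_mx D y = 0 -> map_mx D (x *m y) = 0 :> 'M_2.
  by move=> Dx Dy; rewrite (leibniz_mx (@dA_mul F V)) Dx Dy mul0mx mulmx0 addr0.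
have mx20 : mx2 0 0 0 0 = 0 :> 'M[F]_2.
  by apply/matrixP => i j; rewrite !mxE; case: i => [[|[|]]] //; case: j => [[|[|]]].
have Du a : D a = 0 -> map_mx D (mx2 1 a 0 1) = 0.
  by move=> Da; rewrite !mx2E D1 Da raddf0 mx20.
have Dl a : D a = 0 -> map_mx D (mx2 1 0 a 1) = 0.
  by move=> Da; rewrite !mx2E D1 Da raddf0 mx20.
have nM : neutral V M.
  apply: neutralM0 (neutral_lower2 _) _; first by rewrite Dl // raddfN /= Dp oppr0.
  apply: neutralM0 (neutral_upper2 _) (neutral_lower2 _).
  by rewrite Du // raddfN /= DtX oppr0.
have nMi : neutral V Mi.
  apply: neutralM0 (neutral_lower2 _) _; first by rewrite Dl // raddfN /= DtV oppr0.
  by apply: neutralM0 (neutral_upper2 _) (neutral_lower2 _); rewrite Du.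
have DM0 : map_mx D M = 0.
  by apply: (DM); last apply: (DM); rewrite ?Dl ?Du // raddfN /= ?Dp ?DtX oppr0.
have DMi0 : map_mx D Mi = 0.
  by apply: (DM); last apply: (DM); rewrite ?Dl ?Du // raddfN /= DtV oppr0.
have Od x : x \in vring V -> mx2 x 0 0 1 \is a mxOver (vring V).
  move=> xO; apply/mxOverP => i j; rewrite !mxE.
  by case: i => [[|[|]]] //; case: j => [[|[|]]] //= *; rewrite ?rpred0 ?rpred1.
have [Ud Udi] := mulmx1_unit ddi.
have Kd : integral V d by rewrite /integral Ud (invmx_uniq ddi) !Od.
have Kdi : integral V di by rewrite /integral Udi (invmx_uniq did) !Od.
have EzV : E z^-1 = 0.
  apply: (mulfI z0); rewrite mulr0; have := dB_mul V z z^-1.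
  by rewrite mulfV // E1 Ez mul0r add0r.
have Edi : map_mx E di = 0 by rewrite !mx2E EzV E1 raddf0 mx20.
have step1 := polar_partM (polar_part_neutral nMi)
  (polar_part_neutral (neutral_integral Kdi)).
rewrite dlog_cocycle0l // !addr0 in step1.
have step2 := polar_partM (polar_part_neutral (neutral_integral Kd)) step1.
have := polar_partM (polar_part_neutral nM) step2.
rewrite [X in _ + X]dlog_cocycle0l // !add0r addr0.
congr polar_part; rewrite /dlog_cocycle (invmx_uniq ddi).
have -> : invmx (Mi *m di) = d *m M.
  by apply: invmx_uniq; rewrite mulmxA -[Mi *m di *m d]mulmxA did mulmx1 (mulmx1C MMi).
rewrite (leibniz_mx (@dB_mul F V)) Edi mulmx0 addr0.
rewrite [X in _ *m X]mulmxA -[map_mx E Mi *m di *m d]mulmxA did mulmx1.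
have EtX2 : E (t ^+ 2) = t + t by rewrite expr2 dB_mul Et mulr1 mul1r.
have EtX3 : E (t ^+ 3) = 3%:R * t ^+ 2.
  by rewrite exprS dB_mul Et EtX2 mul1r; ring.
rewrite ME MiE !mx2E !raddfD !raddfN /= E1 Et EtX2 EtX3 Dz D1 !raddf0.
by field; rewrite ?z0 ?oner_neq0.
Qed.

End CuspSymbol.

(** * Linearization *)

Section Companion.

Variables (R : comNzRingType) (a2 a3 a4 a5 b bV : R).

Definition block_companion : 'M[R]_(2 + 8) :=
  mx_of_rows (2 + 8)
    [:: [:: 0; 0; 0; (1 - b) * a2; 0; (1 - b) * (- a3); (1 - bV) * a4; 0; 0; 0];
        [:: 0; 0; (bV - 1) * a2; 0; (bV - 1) * a3; 0; (bV - 1) * a4;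
            (1 - b) * a4; (bV - 1) * a5; 0];
        [:: 1; 0; 0; 0; 0; 0; 0; 0; 0; 0];
        [:: 0; 1; 0; 0; 0; 0; 0; 0; 0; 0];
        [:: 0; 0; 1; 0; 0; 0; 0; 0; 0; 0];
        [:: 0; 0; 0; 1; 0; 0; 0; 0; 0; 0];
        [:: 0; 0; 0; 0; 1; 0; 0; 0; 0; 0];
        [:: 0; 0; 0; 0; 0; 1; 0; 0; 0; 0];
        [:: 0; 0; 0; 0; 0; 0; 1; 0; 0; 0];
        [:: 0; 0; 0; 0; 0; 0; 0; 1; 0; 0]].

Definition rows_of (n m : nat) (rows : seq (seq R)) : 'M[R]_(n, m) :=
  \matrix_(i, j) nth 0 (nth [::] rows i) j.

(** Let N_1, .., N_5 be the 2 x 2 blocks of the first block row.  Adding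
    sum_(l >= j) N_l s^(l - j + 1) times block row j to the first one, for
    j = 2, .., 5, clears the first block row of 1 - s N except for its first
    block, which becomes 1 - sum_l N_l s^l.  The matrix X undoes this. *)
Lemma companion_split (s : R) : exists X Z W,
  [/\ 1%:M - s *: block_companion =
       block_mx 1%:M X 0 1%:M *m
       block_mx (mx_of_rows 2
         [:: [:: 1 - (1 - bV) * (a4 * s ^+ 4);
                 (b - 1) * (a2 * s ^+ 2 - a3 * s ^+ 3)];
             [:: (1 - bV) * (a2 * s ^+ 2 + a3 * s ^+ 3 + a4 * s ^+ 4 + a5 * s ^+ 5);
                 1 + (b - 1) * (a4 * s ^+ 4)]]) 0 Z W,
      is_trig_mx W & forall i, W i i = 1].
Proof.
pose N := 1%:M - s *: block_companion.
pose X := rows_of 2 8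
  [:: [:: (1 - bV) * a4 * s ^+ 3; (1 - b) * (a2 * s - a3 * s ^+ 2);
          (1 - bV) * a4 * s ^+ 2; - ((1 - b) * a3 * s); (1 - bV) * a4 * s; 0; 0; 0];
      [:: (bV - 1) * (a2 * s + a3 * s ^+ 2 + a4 * s ^+ 3 + a5 * s ^+ 4);
          (1 - b) * a4 * s ^+ 3;
          (bV - 1) * (a3 * s + a4 * s ^+ 2 + a5 * s ^+ 3);
          (1 - b) * a4 * s ^+ 2;
          (bV - 1) * (a4 * s + a5 * s ^+ 2); (1 - b) * a4 * s;
          (bV - 1) * a5 * s; 0]].
exists (- X), (dlsubmx N), (drsubmx N); split.
- rewrite -[LHS]/N -[LHS](submxK N) mulmx_block !mul1mx !mul0mx !add0r.
  congr block_mx; apply/matrixP => i j; rewrite !mxE ?big_ord_recl ?big_ord0 !mxE /=.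
    case: i => [[|[|]]] // ?; case: j => [[|[|]]] // ?; rewrite /=; ring.
  by case: i => [[|[|]]] // ?; case: j => [[|[|[|[|[|[|[|[|]]]]]]]]] // ?;
    rewrite /=; ring.
- apply/is_trig_mxP => i j; rewrite !mxE /=.
  by case: i => [[|[|[|[|[|[|[|[|]]]]]]]]] // ?;
    case: j => [[|[|[|[|[|[|[|[|]]]]]]]]] // ? //= _; rewrite mulr0 subr0.
move=> i; rewrite !mxE /=.
by case: i => [[|[|[|[|[|[|[|[|]]]]]]]]] // ?; rewrite /= mulr0 subr0.
Qed.

End Companion.

(** * The field of rational functions in t and z *)

Local Notation QTZ := {poly {poly rat}}.
Local Notation "x %:F" := (@tofrac QTZ x).

Definition tsize (p : QTZ) : nat := size (swapXY p).
Definition der_z : {additive QTZ -> QTZ} := deriv.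
(** Here t is the inner variable, so the derivative in t is the derivative in the
    outer variable after an exchange of the two. *)
Definition der_t : {additive QTZ -> QTZ} := (swapXY \o deriv) \o swapXY.
Definition tP : QTZ := 'X%:P.

Lemma der_zM p q : der_z (p * q) = der_z p * q + p * der_z q.
Proof. exact: derivM. Qed.

Lemma der_tM p q : der_t (p * q) = der_t p * q + p * der_t q.
Proof. by rewrite /der_t /= rmorphM derivM rmorphD !rmorphM /= !swapXYK. Qed.

Lemma tsize_gt0 p : (0 < tsize p)%N = (p != 0).
Proof. by rewrite size_poly_gt0 swapXY_eq0. Qed.

Lemma tsizeM p q : p != 0 -> q != 0 -> (tsize (p * q)).+1 = (tsize p + tsize q)%N.
Proof.
move=> p0 q0; rewrite /tsize rmorphM size_mul ?swapXY_eq0 // prednK //.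
by rewrite addn_gt0 tsize_gt0 p0.
Qed.

Lemma tsizeB p q m : (tsize p <= m -> tsize q <= m -> tsize (p - q) <= m)%N.
Proof.
move=> pm qm; rewrite /tsize rmorphB /= (leq_trans (size_polyD _ _)) //.
by rewrite geq_max size_polyN pm.
Qed.

Lemma tsize_tP : tsize tP = 2.
Proof. by rewrite /tsize /tP swapXY_Y size_polyX. Qed.

Lemma der_z_tP : der_z tP = 0. Proof. exact: derivC. Qed.

Lemma tsize_der_z p : (tsize (der_z p) <= tsize p)%N.
Proof.
apply/leq_sizeP => j le_j; apply/polyP => i.
rewrite coef0 coef_swapXY coef_deriv coefMn -coef_swapXY.
by rewrite (leq_sizeP _ _ le_j j (leqnn _)) coef0 mul0rn.
Qed.

Lemma tsize_der_t p : p != 0 -> (tsize (der_t p) < tsize p)%N.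
Proof. by move=> p0; rewrite /tsize /= swapXYK lt_size_deriv ?swapXY_eq0. Qed.

Lemma tsize_zP : tsize 'X = 1.
Proof. by rewrite /tsize swapXY_X size_polyC polyX_eq0. Qed.

Lemma zP_tP k p : 'X ^+ k != tP * p.
Proof.
apply/eqP => /(congr1 (fun q => (swapXY q).[0])).
rewrite rmorphXn rmorphM /= /tP swapXY_X swapXY_Y hornerM hornerX mul0r.
by rewrite -rmorphXn hornerC => /eqP; rewrite expf_eq0 polyX_eq0 andbF.
Qed.

Definition Qtz_degree : degreeData QTZ :=
  DegreeData tsize_gt0 tsizeM tsizeB tsize_tP tsize_zP zP_tP der_zM der_tM der_z_tP
    tsize_der_z tsize_der_t.

Local Notation V := (degree_biderField Qtz_degree).
Local Notation S := (cuspidal V (localized Qtz_degree)).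
Local Notation T := (vpar_ideal V (localized Qtz_degree)).

Lemma cuspidal_mulST : forall x y, x \in S -> y \in T -> x * y \in T.
Proof. exact: cuspidal_mul_ideal. Qed.

Lemma cuspidal_dAdB_T : forall x y, x \in S -> y \in S -> dA V x * dB V y \in T.
Proof. by apply: cuspidal_dAdB => x; exact: localized_dA. Qed.

(** Cuspidal elements form a subring that contains Q and the generators. *)
Lemma Qgen_cuspidal x : x \in Qgen cusp_gens -> x \in S.
Proof.
move=> /asboolP; apply; first exact: subringClosedP.
  move=> c; apply: (@cuspidal_tofrac _ Qtz_degree _ 0); rewrite mulr0.
  by rewrite /= /der_t /= swapXY_polyC map_polyC derivC rmorph0.
have dX m : der_t (tP ^+ m.+2) = tP * (tP ^+ m *+ m.+2).
  rewrite /der_t /= rmorphXn /= /tP swapXY_Y derivXn rmorphMn rmorphXn /= swapXY_X.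
  by rewrite exprS mulrnAr.
move=> y; rewrite !inE => /or4P[] /eqP->.
- by rewrite -tofracXn; apply: (@cuspidal_tofrac _ Qtz_degree _ _ (dX 0)).
- by rewrite -tofracXn; apply: (@cuspidal_tofrac _ Qtz_degree _ _ (dX 1)).
- apply: (@cuspidal_tofrac _ Qtz_degree _ 0); rewrite mulr0.
  by rewrite /= /der_t /= swapXY_X derivC rmorph0.
apply: (@cuspidal_ZV _ Qtz_degree).
by rewrite /= /der_t /= swapXY_X derivC rmorph0.
Qed.

(** * The two matrices *)

Lemma stab_mx_block (R : pzRingType) n r (A : 'M[R]_n) :
  stab_mx (n + r) A = block_mx A 0 0 1%:M.
Proof.
apply/matrixP => i j; rewrite mxE.
case: (split_ordP i) => i' ->; case: (split_ordP j) => j' ->;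
  rewrite ?block_mxEul ?block_mxEur ?block_mxEdl ?block_mxEdr ?mxE /=.
- rewrite !insubT //= => ? ?; congr (A _ _); exact: val_inj.
- rewrite insubT //= => ?; rewrite insubF ?eq_lrshift //.
  by rewrite ltnNge leq_addr.
- by rewrite insubF ?eq_rlshift // ltnNge leq_addr.
by rewrite insubF ?eq_rshift // ltnNge leq_addr.
Qed.

Lemma stab_mx_id (R : pzRingType) n (A : 'M[R]_n) : stab_mx n A = A.
Proof.
by apply/matrixP => i j; rewrite mxE !insubT //= => ? ?; congr (A _ _); exact: val_inj.
Qed.

Lemma stab_mx_one (R : pzRingType) m : stab_mx m (GL_mx (GL_one R)) = 1%:M.
Proof.
by apply/matrixP => i j; rewrite !mxE insubF.
Qed.

(** The inverse of 1 - X N over R[X] is its adjugate, a polynomial in X, and its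
    coefficients are the powers of N. *)
Lemma nilpotent_of_det1 (R : comNzRingType) n (N : 'M[R]_n) :
  \det (1%:M - 'X *: map_mx polyC N) = 1 -> mx_nilpotent N.
Proof.
set M := 1%:M - _ => detM; pose B := \adj M.
have MB : B - 'X *: (map_mx polyC N *m B) = 1%:M.
  by rewrite -detM -mul_mx_adj mulmxBl mul1mx scalemxAl.
pose C k := map_mx (coefp k) B.
have C0 : C 0%N = 1%:M.
  apply/matrixP => i j; have /matrixP/(_ i j)/(congr1 (coefp 0)) := MB.
  by rewrite !mxE /= coefB coefXM subr0 coefMn coef1.
have CS k : C k.+1 = N *m C k.
  apply/matrixP => i j; have /matrixP/(_ i j)/(congr1 (coefp k.+1)) := MB.
  rewrite !mxE /= coefB coefXM /= coefMn coef1 mul0rn => /eqP.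
  rewrite subr_eq0 => /eqP->; rewrite coef_sum; apply: eq_bigr => l _.
  by rewrite !mxE coefCM.
have CX k : C k = N ^+ k by elim: k => [|k IHk]; rewrite ?C0 // CS IHk exprS.
exists (\max_(p : 'I_n * 'I_n) size (B p.1 p.2))%N; rewrite -CX.
apply/matrixP => i j; rewrite [LHS]mxE [RHS]mxE /= nth_default //.
exact: (leq_bigmax (F := fun p : 'I_n * 'I_n => size (B p.1 p.2)) (i, j)).
Qed.

Lemma det_cusp_matrix (R : comNzRingType) (a2 a3 a4 a5 b bV : R) :
  a2 * a2 = a4 -> a2 * a4 = a3 * a3 -> a2 * a5 = a3 * a4 -> a3 * a5 = a4 * a4 ->
  b * bV = 1 ->
  \det (mx_of_rows 2 [:: [:: 1 - (1 - bV) * a4; (b - 1) * (a2 - a3)];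
    [:: (1 - bV) * (a2 + a3 + a4 + a5); 1 + (b - 1) * a4]]) = 1.
Proof.
move=> s22 s24 s25 s35 bbV.
rewrite (expand_det_row _ 0) !big_ord_recl big_ord0 addr0 !mxE /cofactor !det_mx11 !mxE /=.
have pq : (a2 - a3) * (a2 + a3 + a4 + a5) = a4 - a4 * a4.
  have -> : (a2 - a3) * (a2 + a3 + a4 + a5) =
      a2 * a2 + (a2 * a4 - a3 * a3) + (a2 * a5 - a3 * a4) - a3 * a5 by ring.
  by rewrite s22 s24 s25 s35 !subrr !addr0.
have bb : (b - 1) * (1 - bV) = (b - 1) - (1 - bV).
  have -> : (b - 1) * (1 - bV) = b - b * bV - 1 + bV by ring.
  by rewrite bbV; ring.
have -> : forall x y u v : R, x * ((-1) ^+ (0 + 0) * y) + u * ((-1) ^+ (0 + 1) * v) =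
    x * y - u * v by move=> x y u v; rewrite addn0 add0n expr0 expr1; ring.
have -> : (1 - (1 - bV) * a4) * (1 + (b - 1) * a4)
    - (b - 1) * (a2 - a3) * ((1 - bV) * (a2 + a3 + a4 + a5)) =
  1 + ((b - 1) - (1 - bV)) * a4 - (b - 1) * (1 - bV) * (a4 * a4)
    - (b - 1) * (1 - bV) * ((a2 - a3) * (a2 + a3 + a4 + a5)) by ring.
by rewrite pq bb; ring.
Qed.

Lemma polyCXnM (R : comNzRingType) (a b : R) k l :
  (a%:P * 'X^k) * (b%:P * 'X^l) = (a * b)%:P * 'X^(k + l).
Proof. by rewrite mulrACA polyCM exprD. Qed.

Lemma cusp_valM (x y : cuspRing) : cusp_val (x * y) = cusp_val x * cusp_val y.
Proof. by []. Qed.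

Lemma det_mxA : \det mxA = 1.
Proof.
have valI : injective cusp_val by exact: val_inj.
have e22 : t2 * t2 = t4 by apply: valI; rewrite cusp_valM; exact: esym (exprD tF 2 2).
have e24 : t2 * t4 = t3 * t3.
  by apply: valI; rewrite !cusp_valM; exact: etrans (esym (exprD tF 2 4)) (exprD tF 3 3).
have e25 : t2 * t5 = t3 * t4.
  by apply: valI; rewrite !cusp_valM; exact: etrans (esym (exprD tF 2 5)) (exprD tF 3 4).
have e35 : t3 * t5 = t4 * t4.
  by apply: valI; rewrite !cusp_valM; exact: etrans (esym (exprD tF 3 5)) (exprD tF 4 4).
have zF0 : zF != 0 by rewrite tofrac_eq0 polyX_eq0.
have zzV : z * zV = 1 by apply: valI; rewrite cusp_valM; exact: mulfV zF0.
by apply: det_cusp_matrix; rewrite /st2 /st3 /st4 /st5 -?polyCM ?polyCXnM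
  ?e22 ?e24 ?e25 ?e35 ?zzV.
Qed.

Lemma GLover_map_det1 (F : fieldType) (S : subringClosed F) (R : comNzRingType)
    (f : {rmorphism R -> F}) n (M : 'M[R]_n) :
  (forall x, f x \in S) -> \det M = 1 -> GLover S (map_mx f M).
Proof.
move=> fS detM; apply: (@GLover_intro _ _ _ _ (map_mx f (\adj M))).
- by rewrite -map_mxM mul_mx_adj detM map_mx1.
- by apply/mxOverP => i j; rewrite mxE.
- by apply/mxOverP => i j; rewrite mxE.
Qed.

Lemma neutral_block_upper (F : fieldType) (V : biderField F) n m (X : 'M_(n, m)) :
  neutral V (block_mx 1%:M X 0 1%:M).
Proof.
apply: (neutral_unipotent _ (w := fun i : 'I_(n + m) => (i < n) : nat)) => [|i j].
  by rewrite det_ublock !det1 mulr1.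
case: (split_ordP i) => i' ->; case: (split_ordP j) => j' -> /=;
  rewrite ?block_mxEul ?block_mxEur ?block_mxEdl ?block_mxEdr ?mxE
    ?eq_lshift ?eq_rshift ?eq_rlshift // ?ltn_ord.
Qed.

Lemma neutral_lower (F : fieldType) (V : biderField F) n (W : 'M_n) :
  is_trig_mx W -> (forall i, W i i = 1) -> neutral V W.
Proof.
move=> tW W1; apply: (neutral_unipotent _ (w := fun i => i : nat)) => [|i j].
  by rewrite det_trig // big1.
rewrite leq_eqVlt => /orP[/eqP/val_inj->|ij]; first by rewrite W1 eqxx.
by rewrite (is_trig_mxP tW) // -val_eqE ltn_eqF.
Qed.

(** The specialization s = 1.  Nothing is lost, since the entries of [mxA] are
    polynomials in s t: the substitution of s t for t recovers the matrix. *)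
Definition cusp_eval : {rmorphism {poly cuspRing} -> Qtz} :=
  (val : {rmorphism cuspRing -> Qtz}) \o horner_eval (1 : cuspRing).

Lemma cusp_evalE p : cusp_eval p = cusp_val p.[1].
Proof. by []. Qed.

Lemma cusp_eval_monomial a k : cusp_eval (a%:P * 'X^k) = cusp_val a.
Proof. by rewrite cusp_evalE hornerCM hornerXn expr1n mulr1. Qed.

Lemma cusp_evalC a : cusp_eval a%:P = cusp_val a.
Proof. by rewrite cusp_evalE hornerC. Qed.

Lemma cusp_evalS p : cusp_eval p \in S.
Proof. exact: Qgen_cuspidal (cusp_valP _). Qed.

Lemma map_cusp_matrix (R F : nzRingType) (f : {rmorphism R -> F})
    (a2 a3 a4 a5 b bV : R) (x2 x3 x4 x5 y yV : F) :
  f a2 = x2 -> f a3 = x3 -> f a4 = x4 -> f a5 = x5 -> f b = y -> f bV = yV ->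
  map_mx f (mx_of_rows 2
    [:: [:: 1 - (1 - bV) * a4; (b - 1) * (a2 - a3)];
        [:: (1 - bV) * (a2 + a3 + a4 + a5); 1 + (b - 1) * a4]]) =
  mx_of_rows 2
    [:: [:: 1 - (1 - yV) * x4; (y - 1) * (x2 - x3)];
        [:: (1 - yV) * (x2 + x3 + x4 + x5); 1 + (y - 1) * x4]].
Proof.
move=> <- <- <- <- <- <-.
by rewrite map_mx_of_rows2 !(rmorphB, rmorphD, rmorphM, rmorph1).
Qed.

Local Notation symb := ((1 + tF + tF ^+ 2 - tF ^+ 3) / zF).

Lemma map_mxA : map_mx cusp_eval mxA =
  mx_of_rows 2
    [:: [:: 1 - (1 - zF^-1) * tF ^+ 4; (zF - 1) * (tF ^+ 2 - tF ^+ 3)];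
        [:: (1 - zF^-1) * (tF ^+ 2 + tF ^+ 3 + tF ^+ 4 + tF ^+ 5);
            1 + (zF - 1) * tF ^+ 4]].
Proof.
exact: map_cusp_matrix (cusp_eval_monomial t2 2) (cusp_eval_monomial t3 3)
  (cusp_eval_monomial t4 4) (cusp_eval_monomial t5 5) (cusp_evalC z) (cusp_evalC zV).
Qed.

Lemma zF_neq0 : zF != 0.
Proof. by rewrite tofrac_eq0 polyX_eq0. Qed.

Lemma zF_bounded : zF \in vring V.
Proof.
have s1 : tsize 1 = 1 := sz1 Qtz_degree.
have := @bounded_intro _ Qtz_degree 'X 1 (oner_neq0 _); rewrite tofrac1 divr1; apply.
by rewrite /= s1 tsize_zP.
Qed.

Lemma zFV_bounded : zF^-1 \in vring V.
Proof.
have s1 : tsize 1 = 1 := sz1 Qtz_degree.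
have := @bounded_intro _ Qtz_degree 1 'X (negbT (polyX_eq0 _)); rewrite tofrac1 div1r; apply.
by rewrite /= s1 tsize_zP.
Qed.

Lemma dA_tofrac p : dA V p%:F = (der_z p)%:F.
Proof. exact: frac_der_tofrac der_zM p. Qed.

Lemma dB_tofrac p : dB V p%:F = (der_t p)%:F.
Proof. exact: frac_der_tofrac der_tM p. Qed.

Lemma dA_zF : dA V zF = 1.
Proof.
have zX : der_z 'X = 1 by exact: derivX.
by apply: etrans (dA_tofrac 'X) _; rewrite zX tofrac1.
Qed.

Lemma dB_zF : dB V zF = 0.
Proof.
have tX : der_t 'X = 0 by rewrite /der_t /= swapXY_X derivC rmorph0.
by apply: etrans (dB_tofrac 'X) _; rewrite tX tofrac0.
Qed.

Lemma dB_tF : dB V tF = 1.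
Proof.
have tY : der_t tP = 1 by rewrite /der_t /= swapXY_Y derivX rmorph1.
by apply: etrans (dB_tofrac tP) _; rewrite tY tofrac1.
Qed.

Lemma polar_class_mxA : polar_class V T (map_mx cusp_eval mxA) symb.
Proof.
apply: polar_class_part; rewrite map_mxA.
exact: cusp_symbol zF_neq0 zF_bounded zFV_bounded dA_zF dB_zF dB_tF.
Qed.

Lemma symb_neq0 : symb \notin polar_mod V T.
Proof. exact: cusp_symbol_neq0 Qtz_degree. Qed.

Lemma mxA_not_elementary r E :
  El_mx E -> stab_mx (2 + r) mxA = E -> False.
Proof.
move=> /(polar_class_El cuspidal_mulST cuspidal_dAdB_T cusp_evalS)[_ cE] AE.
move: cE; rewrite -AE stab_mx_block map_block_mx !map_mx0 map_mx1 => cE.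
have /negP[] := symb_neq0; rewrite -[symb]subr0 -[X in X - 0]addr0.
apply: polar_class_uniq cE; apply: polar_class_block; last exact: polar_class1.
exact: polar_class_mxA.
Qed.

Lemma mxA_invertible : mx_invertible mxA.
Proof.
by exists (\adj mxA); rewrite mul_mx_adj mul_adj_mx det_mxA.
Qed.

Lemma in_NK1_mxA (hA : mx_invertible mxA) : in_NK1 (MkGL hA).
Proof.
exists 2%N, 1%:M; rewrite mul1mx stab_mx_one; split=> //; first exact: El_mx1.
rewrite stab_mx_id /=.
have -> : map_mx (coefp 0) mxA = 1%:M.
  have st0 (a : cuspRing) k : coefp 0 (a%:P * 'X^(k.+1)) = 0 by rewrite /= coefMXn.
  have b0 (a : cuspRing) : coefp 0 a%:P = a by rewrite /= coefC.
  apply: etrans (map_cusp_matrix (f := coefp 0) (st0 t2 1%N) (st0 t3 2) (st0 t4 3)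
    (st0 t5 4) (b0 z) (b0 zV)) _.
  by rewrite !(mulr0, subr0, addr0) scalar_mx_of_rows2.
by [].
Qed.

Lemma map_block_companion (R R' : comNzRingType) (f : {rmorphism R -> R'})
    (a2 a3 a4 a5 b bV : R) :
  map_mx f (block_companion a2 a3 a4 a5 b bV) =
  block_companion (f a2) (f a3) (f a4) (f a5) (f b) (f bV).
Proof.
apply/matrixP => i j; rewrite !mxE.
case: i => [[|[|[|[|[|[|[|[|[|[|]]]]]]]]]]] // ?;
  case: j => [[|[|[|[|[|[|[|[|[|[|]]]]]]]]]]] // ?;
  by rewrite /= ?(rmorphM, rmorphB, rmorphN, rmorph0, rmorph1).
Qed.

Lemma mxN_split : exists X Z W,
  [/\ 1%:M - 'X *: map_mx polyC mxN = block_mx 1%:M X 0 1%:M *m block_mx mxA 0 Z W,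
      is_trig_mx W & forall i, W i i = 1].
Proof.
have [X [Z [W [e tW W1]]]] :=
  companion_split t2%:P t3%:P t4%:P t5%:P z%:P zV%:P ('X : {poly cuspRing}).
exists X, Z, W; split=> //; apply: etrans e.
congr (_ - _ *: _); exact: map_block_companion t2 t3 t4 t5 z zV.
Qed.

Lemma det_mxN : \det (1%:M - 'X *: map_mx polyC mxN) = 1.
Proof.
have [X [Z [W [-> tW W1]]]] := mxN_split.
have dU : \det (block_mx 1%:M X 0 1%:M) = 1 by rewrite det_ublock !det1 mulr1.
have dB : \det (block_mx mxA 0 Z W) = 1.
  by rewrite det_lblock det_mxA det_trig // big1 // mulr1.
by apply: etrans (det_mulmx _ _) _; apply: etrans (congr2 *%R dU dB) (mulr1 1).
Qed.

(** The specialization at s = 1 of [mxN_split]. *)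
Lemma polar_class_mxN : polar_class V T (map_mx (\val : cuspRing -> Qtz) (1%:M - mxN)) symb.
Proof.
have -> : map_mx (\val : cuspRing -> Qtz) (1%:M - mxN) =
    map_mx cusp_eval (1%:M - 'X *: map_mx polyC mxN).
  apply/matrixP => i j; rewrite [LHS]mxE [RHS]mxE cusp_evalE; congr cusp_val.
  by rewrite !mxE hornerD hornerN hornerM hornerX hornerC mul1r hornerMn hornerC.
have [X [Z [W [e tW W1]]]] := mxN_split.
have dU : \det (block_mx 1%:M X 0 1%:M) = 1 by rewrite det_ublock !det1 mulr1.
have dB : \det (block_mx mxA 0 Z W) = 1.
  by rewrite det_lblock det_mxA det_trig // big1 // mulr1.
have cU : polar_class V T (map_mx cusp_eval (block_mx 1%:M X 0 1%:M)) 0.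
  rewrite map_block_mx !map_mx1 map_mx0.
  exact/polar_class_part/polar_part_neutral/neutral_block_upper.
have cB : polar_class V T (map_mx cusp_eval (block_mx mxA 0 Z W)) symb.
  rewrite map_block_mx map_mx0 -[symb]addr0.
  apply: polar_class_block; first exact: polar_class_mxA.
  apply/polar_class_part/polar_part_neutral/neutral_lower => [|i].
    by apply/is_trig_mxP => i j ij; rewrite mxE (is_trig_mxP tW) // rmorph0.
  by rewrite mxE W1 rmorph1.
rewrite e map_mxM -[symb]add0r.
apply: (polar_classM cuspidal_mulST cuspidal_dAdB_T _ _ cU cB).
  exact: GLover_map_det1 cusp_evalS dU.
exact: GLover_map_det1 cusp_evalS dB.
Qed.

Theorem theorem3p1 :
  (exists hA : mx_invertible mxA,
     in_NK1 (MkGL hA) /\ ~ K1_eq (MkGL hA) (GL_one {poly cuspRing})) /\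
  (exists hN : mx_nilpotent mxN,
     ~ Nil0_eq (Nil0_class hN) K0_zero).
Proof.
split.
  exists mxA_invertible; split; first exact: in_NK1_mxA.
  case=> m [E [/= m2 _ El]]; rewrite stab_mx_one mulmx1.
  by move: E El; rewrite -(subnKC m2) => E El; apply: mxA_not_elementary El.
exists (nilpotent_of_det1 det_mxN) => N0; have /negP[] := symb_neq0.
apply: (Nil0_eq0_polar cuspidal_mulST cuspidal_dAdB_T _ polar_class_mxN N0) => x.
exact: Qgen_cuspidal (cusp_valP x).
Qed.
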